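(* Let $C\subseteq\mathbb{P}^N(\overline{\mathbb{Q}}_p)$ be an irreducible smooth projective curve with good reduction, and let $\phi:C\to C$ be a morphism of good reduction with degree $d>1$. For every point $x\in C$ and every real $r<1$, the number of points $y\in C$ that are periodic under $\phi$ and satisfy $\Delta(x,y)<r$ is finite.
   Context: $p$ is a prime, $\overline{\mathbb{Q}}_p$ is the algebraic closure of $\mathbb{Q}_p$, and $|\cdot|$ is the $p$-adic absolute value with $|p|=1/p$. Put $O_p=\{z\in\overline{\mathbb{Q}}_p: |z|\le 1\}$, $\mathfrak{p}=\{z\in\overline{\mathbb{Q}}_p:|z|<1\}$, and identify $O_p/\mathfrak{p}$ with $\overline{\mathbb{F}}_p$. Homogeneous coordinates $X=(X_0,\dots,X_N)$ of a point $x=[X]\in\mathbb{P}^N(\overline{\mathbb{Q}}_p)$ are always chosen with $\max_i|X_i|=1$. The metric $\Delta$ is $\Delta([X],[Y])=\max_{i,j}|X_iY_j-X_jY_i|$. Good reduction of curves. Let $C\subseteq\mathbb{P}^N(\overline{\mathbb{Q}}_p)$ be an irreducible projective curve with homogeneous ideal of relations $I=I(C)$. Let $J=I\cap O_p[T_0,\dots,T_N]$ be generated by forms $f_1,\dots,f_t$. At a point $y=[Y]\in C$ with, say, $Y_0\ne0$ (similarly for another nonzero coordinate), $C$ is non-singular at $y$ if $\operatorname{rank}\left(\frac{\partial g_i}{\partial U_j}(y)\right)_{i,j}=N-1$, where $g_i(U_1,\dots,U_N)=f_i(1,U_1,\dots,U_N)$. $C$ is smooth if it is non-singular at every point. Let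 $\overline{J}\subset\overline{\mathbb{F}}_p[T_0,\dots,T_N]$ be the reduction of $J$ modulo $\mathfrak{p}$ and $\overline{C}\subset\mathbb{P}^N(\overline{\mathbb{F}}_p)$ the variety defined by $\overline{J}$. $C$ has good reduction if the same rank condition, for the reductions of the $g_i$ modulo $\mathfrak p$, holds at every $\bar y\in\overline{C}$. Good reduction of morphisms. A morphism $\phi:C\to C$ is given by forms $(F_0,\dots,F_N)$ of the same degree over $\overline{\mathbb{Q}}_p$, not all in $I$. Forms $(G_0,\dots,G_N)$ of equal degree represent $\phi$ if $F_iG_j-F_jG_i\in I$ for all $i,j$; being a morphism requires that at each $x=[X]\in C$ there is a representation with $(G_0(X),\dots,G_N(X))\neq 0$. $\phi$ has good reduction if for every $\bar x=[\bar X]\in\overline{C}$ there is a representation $(G_0,\dots,G_N)$ of $\phi$ with all $G_i\in O_p[T_0,\dots,T_N]$ such that the reductions $\overline{G}_i(\bar X)\in\overline{\mathbb{F}}_p$ are not all zero. The degree of $\phi$ is $[K:\phi^*(K)]$, where $K$ is the field of rational functions on $C$ and $\phi^*f=f\circ\phi$. A point $y$ is periodic if $\phi^n(y)=y$ for some $n\ge1$, where $\phi^n$ is the $n$-th iterate. *)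

(* Defs.v *)
From HB Require Import structures.
From mathcomp Require Import all_boot all_order all_algebra.
From mathcomp Require Import boolp classical_sets cardinality reals.
From mathcomp Require Import mpoly.

Set Implicit Arguments.
Unset Strict Implicit.
Unset Printing Implicit Defensive.

Import Order.TTheory GRing.Theory Num.Theory.
Local Open Scope ring_scope.
Local Open Scope classical_set_scope.

(* [is_padic_closure p emb v]: Qp is the completion of the rationals for the
   p-adic absolute value, K is an algebraic closure of it via emb, and v is the
   p-adic absolute value of K.  This determines (Qp, K, v) up to isometric
   isomorphism. *)
Record is_padic_closure (R : realType) (p : nat) (Qp : fieldType)
    (K : closedFieldType) (emb : {rmorphism Qp -> K}) (v : K -> R) : Prop := {
  pabs_ge0 : forall x, 0 <= v x;
  pabs_eq0 : forall x, v x = 0 <-> x = 0;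
  pabsM : forall x y, v (x * y) = v x * v y;
  pabs_ultra : forall x y, v (x + y) <= Num.max (v x) (v y);
  pabs_p : v p%:R = p%:R^-1;
  rat_dense : forall (x : Qp) (eps : R), 0 < eps ->
    exists q : rat, v (emb (x - ratr q)) < eps;
  Qp_complete : forall u : nat -> Qp,
    (forall eps : R, 0 < eps -> exists n : nat, forall i j : nat,
       (n <= i)%N -> (n <= j)%N -> v (emb (u i - u j)) < eps) ->
    exists l : Qp, forall eps : R, 0 < eps -> exists n : nat, forall i : nat,
       (n <= i)%N -> v (emb (u i - l)) < eps;
  closure_algebraic : forall x : K, algebraicOver emb x
}.

Definition Oint (R : realType) (K : fieldType) (v : K -> R) : {pred K} :=
  [pred x | v x <= 1].

(* [is_reduction v red]: the restriction of red to O_p is a surjective ring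
   morphism with kernel {v < 1}, i.e. it identifies O_p/{v < 1} with k.  The
   values of red outside O_p are irrelevant. *)
Record is_reduction (R : realType) (K k : fieldType) (v : K -> R)
    (red : K -> k) : Prop := {
  red1 : red 1 = 1;
  redD : {in Oint v &, {morph red : x y / x + y}};
  redM : {in Oint v &, {morph red : x y / x * y}};
  red_eq0 : forall x, x \in Oint v -> (red x = 0 <-> v x < 1);
  red_surj : forall z, exists2 x, x \in Oint v & red x = z
}.

(* Points of P^N(K) are the lines of K^(N+1), equality being Leibniz. *)
Record pspace (K : fieldType) (N : nat) := PPoint {
  pline : {vspace 'rV[K]_N.+1};
  _ : \dim pline == 1%N
}.
HB.instance Definition _ (K : fieldType) (N : nat) :=
  [isSub of pspace K N for @pline K N].
HB.instance Definition _ (K : fieldType) (N : nat) :=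
  [Choice of pspace K N by <:].

(* x = [X]; since pline x has dimension 1, this forces X != 0. *)
Definition hcoords (K : fieldType) (N : nat) (x : pspace K N)
  (X : 'rV[K]_N.+1) : Prop := pline x = <[X]>%VS.

(* Coordinates of x divided by one of maximal absolute value, so that
   max_i v(X_i) = 1. *)
Definition unit_coords (R : realType) (K : fieldType) (N : nat) (v : K -> R)
    (x : pspace K N) : 'rV[K]_N.+1 :=
  let X := vpick (pline x) in
  (X 0 [arg max_(i > ord0) v (X 0 i)]%O)^-1 *: X.

Definition Delta (R : realType) (K : fieldType) (N : nat) (v : K -> R)
    (x y : pspace K N) : R :=
  let X := unit_coords v x in let Y := unit_coords v y in
  \big[Num.max/0]_(i < N.+1) \big[Num.max/0]_(j < N.+1)
    v (X 0 i * Y 0 j - X 0 j * Y 0 i).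

Definition is_form (K : fieldType) (n : nat) (F : {mpoly K[n]}) : Prop :=
  exists e : nat, F \is e.-homog.

Definition vanishes_at (K : fieldType) (N : nat) (F : {mpoly K[N.+1]})
    (x : pspace K N) : Prop :=
  forall X, hcoords x X -> F.@[X 0] = 0.

Definition zariski_closed (K : fieldType) (N : nat) (Z : set (pspace K N)) :
    Prop :=
  exists2 S : set {mpoly K[N.+1]}, S `<=` @is_form K N.+1 &
    Z = [set x | forall F, S F -> vanishes_at F x].

Definition irreducible_closed (K : fieldType) (N : nat)
    (Z : set (pspace K N)) : Prop :=
  [/\ zariski_closed Z, Z !=set0 &
      forall A B, zariski_closed A -> zariski_closed B ->
        Z `<=` A `|` B -> Z `<=` A \/ Z `<=` B].

Definition closed_chain (K : fieldType) (N : nat) (C : set (pspace K N))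
    (n : nat) : Prop :=
  exists Z : nat -> set (pspace K N),
    (forall i, (i <= n)%N -> irreducible_closed (Z i) /\ Z i `<=` C) /\
    (forall i, (i < n)%N -> Z i `<` Z i.+1).

(* Krull dimension for the Zariski topology. *)
Definition has_dim (K : fieldType) (N : nat) (C : set (pspace K N)) (n : nat) :
    Prop :=
  closed_chain C n /\ ~ closed_chain C n.+1.

Definition irreducible_curve (K : fieldType) (N : nat)
    (C : set (pspace K N)) : Prop :=
  irreducible_closed C /\ has_dim C 1.

(* The polynomials vanishing at all homogeneous coordinates of all points of
   C; over an infinite field this is the ideal generated by the forms
   vanishing on C. *)
Definition ideal_of (K : fieldType) (N : nat) (C : set (pspace K N)) :
    set {mpoly K[N.+1]} :=
  [set F | forall x, C x -> vanishes_at F x].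

Definition int_ideal_of (R : realType) (K : fieldType) (N : nat) (v : K -> R)
    (C : set (pspace K N)) : set {mpoly K[N.+1]} :=
  [set F | ideal_of C F /\ F \is a mpolyOver N.+1 (Oint v)].

Definition generates_int_ideal (R : realType) (K : fieldType) (N : nat)
    (v : K -> R) (C : set (pspace K N)) (t : nat)
    (f : 'I_t -> {mpoly K[N.+1]}) : Prop :=
  (forall i, is_form (f i)) /\
  forall F, int_ideal_of v C F <->
    exists2 c : 'I_t -> {mpoly K[N.+1]},
      forall i, c i \is a mpolyOver N.+1 (Oint v) & F = \sum_(i < t) c i * f i.

(* Substitution of 1 for the a-th variable, the other variables being
   renumbered. *)
Definition dehom (K : fieldType) (N : nat) (a : 'I_N.+1)
    (F : {mpoly K[N.+1]}) : {mpoly K[N]} :=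
  F \mPo [tuple if unlift a j is Some j' then 'X_j' else 1 | j < N.+1].

(* Jacobian criterion in every affine chart containing y; [g a] is the family
   of local equations in the chart where the a-th coordinate is nonzero. *)
Definition nonsingular_at (K : fieldType) (N t : nat)
    (g : 'I_N.+1 -> 'I_t -> {mpoly K[N]}) (y : pspace K N) : Prop :=
  forall (Y : 'rV[K]_N.+1) (a : 'I_N.+1), hcoords y Y -> Y 0 a != 0 ->
    \rank (\matrix_(i < t, j < N)
             ((g a i)^`M(j)).@[fun l => Y 0 (lift a l) / Y 0 a]) = N.-1.

Definition smooth_curve (K : fieldType) (N t : nat) (C : set (pspace K N))
    (f : 'I_t -> {mpoly K[N.+1]}) : Prop :=
  forall y, C y -> nonsingular_at (fun a i => dehom a (f i)) y.

Definition reduced_curve (R : realType) (K k : fieldType) (N : nat)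
    (v : K -> R) (red : K -> k) (C : set (pspace K N)) : set (pspace k N) :=
  [set y | forall F, int_ideal_of v C F -> vanishes_at (map_mpoly red F) y].

Definition curve_good_reduction (R : realType) (K k : fieldType) (N t : nat)
    (v : K -> R) (red : K -> k) (C : set (pspace K N))
    (f : 'I_t -> {mpoly K[N.+1]}) : Prop :=
  forall y, reduced_curve v red C y ->
    nonsingular_at (fun a i => map_mpoly red (dehom a (f i))) y.

Definition forms_of_degree (K : fieldType) (n m e : nat)
    (F : m.-tuple {mpoly K[n]}) : Prop :=
  forall i, tnth F i \is e.-homog.

Definition eval_forms (K : fieldType) (n m : nat) (F : m.-tuple {mpoly K[n]})
    (X : 'rV[K]_n) : 'rV[K]_m :=
  \row_i (tnth F i).@[X 0].

Definition represents (K : fieldType) (N : nat) (C : set (pspace K N))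
    (F G : N.+1.-tuple {mpoly K[N.+1]}) : Prop :=
  (exists e : nat, forms_of_degree e G) /\
  forall i j, ideal_of C (tnth F i * tnth G j - tnth F j * tnth G i).

(* phi is a total map of P^N, but only its restriction to C matters. *)
Record is_morphism (K : fieldType) (N : nat) (C : set (pspace K N))
    (F : N.+1.-tuple {mpoly K[N.+1]}) (phi : pspace K N -> pspace K N) :
    Prop := {
  morphism_forms : exists e : nat, forms_of_degree e F;
  morphism_nontrivial : exists i, ~ ideal_of C (tnth F i);
  morphism_stable : forall x, C x -> C (phi x);
  morphism_eval : forall x, C x -> exists2 G, represents C F G &
    forall X, hcoords x X ->
      eval_forms G X != 0 /\ hcoords (phi x) (eval_forms G X)
}.

Definition morphism_good_reduction (R : realType) (K k : fieldType) (N : nat)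
    (v : K -> R) (red : K -> k) (C : set (pspace K N))
    (F : N.+1.-tuple {mpoly K[N.+1]}) : Prop :=
  forall x, reduced_curve v red C x ->
    exists G, [/\ represents C F G,
      forall i, tnth G i \is a mpolyOver N.+1 (Oint v) &
      forall X, hcoords x X -> eval_forms (map_tuple (map_mpoly red) G) X != 0].

(* [is_coord_fraction_field C pi]: via pi, L is the field of fractions of the
   homogeneous coordinate ring K[T_0, ..., T_N]/I(C). *)
Definition is_coord_fraction_field (K : fieldType) (N : nat)
    (C : set (pspace K N)) (L : fieldType)
    (pi : {rmorphism {mpoly K[N.+1]} -> L}) : Prop :=
  (forall F, pi F = 0 <-> ideal_of C F) /\
  (forall h, exists G H, pi H != 0 /\ h = pi G / pi H).

(* The field K(C), as the elements of degree 0 of L. *)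
Definition rational_functions (K : fieldType) (N : nat) (L : fieldType)
    (pi : {rmorphism {mpoly K[N.+1]} -> L}) : set L :=
  [set h | exists e G H, [/\ G \is e.-homog, H \is e.-homog, pi H != 0 &
                             h = pi G / pi H]].

(* phi^* K(C), where phi^*(G/H) = G(F)/H(F).  If phi is nonconstant, H(F) is
   never zero on all of C.  If phi is constant, only those G/H with H(F) nonzero
   on C can be pulled back, and the set obtained is the field of constants. *)
Definition pullback_functions (K : fieldType) (N : nat)
    (F : N.+1.-tuple {mpoly K[N.+1]}) (L : fieldType)
    (pi : {rmorphism {mpoly K[N.+1]} -> L}) : set L :=
  [set h | exists e G H, [/\ G \is e.-homog, H \is e.-homog,
                             pi H != 0, pi (H \mPo F) != 0 &
                             h = pi (G \mPo F) / pi (H \mPo F)]].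

(* [M : S] = d for subfields S <= M of L: M has an S-basis with d elements. *)
Definition ext_degree (L : fieldType) (M S : set L) (d : nat) : Prop :=
  exists b : 'I_d -> L, (forall i, M (b i)) /\
    forall x, M x -> exists! c : {ffun 'I_d -> L},
      (forall i, S (c i)) /\ x = \sum_(i < d) c i * b i.

(* The choice of L is irrelevant, since it is unique up to isomorphism. *)
Definition morphism_degree (K : fieldType) (N : nat) (C : set (pspace K N))
    (F : N.+1.-tuple {mpoly K[N.+1]}) (d : nat) : Prop :=
  exists (L : fieldType) (pi : {rmorphism {mpoly K[N.+1]} -> L}),
    is_coord_fraction_field C pi /\
    ext_degree (rational_functions pi) (pullback_functions F pi) d.

Definition periodic (T : Type) (phi : T -> T) (y : T) : Prop :=
  exists2 n : nat, (0 < n)%N & iter n phi y = y.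

(* Main.v *)
Require Import Defs.
From HB Require Import structures.
From mathcomp Require Import all_boot all_order all_algebra.
From mathcomp Require Import boolp classical_sets cardinality reals.
From mathcomp Require Import mpoly.
From mathcomp Require Import zify ring.

Set Implicit Arguments.
Unset Strict Implicit.
Unset Printing Implicit Defensive.

Import Order.TTheory GRing.Theory Num.Theory.
Local Open Scope ring_scope.
Local Open Scope classical_set_scope.

(** The periodic points at distance less than [r] of [x] have a common period
[n], by a local argument; and [phi^n] cannot have infinitely many fixed points,
by a global one.

Local part.  If there is such a periodic point [y0], let [phi^m y0 = y0].  By
good reduction [phi^m] is given on the residue disc of [y0] by a composition of
polynomial maps over the valuation ring one of whose coordinates is a unit
([disc_chain]).  It does not expand distances, so it permutes the set [T] of
periodic points of a smaller closed disc of radius [v c], [r <= v c < 1].  In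
affine coordinates centered at [y0] and divided by [c], this return map is
congruent to a linear map [A] modulo [c] (the lemmas on [first_order]).  The
entries of [A] reduce to elements of a finite field, so some power of [A] is
idempotent modulo some [b], [v b < 1] ([idempotent_mod_maximal]); since the
return map is onto [T], this power of [A] acts on [T] as the identity modulo [b],
and so a power [h] of the return map induces the identity modulo [b] on the
algebra of integral functions ([linear_mod_idem]).  Then [h^(p^s)] induces the
identity modulo [b^(s+1)] ([trivial_mod_power]), and as soon as this is smaller
than [p], a point that is periodic under [h^(p^s)] is fixed by it
([trivial_mod_fixed]).  Indeed the period can be taken to be [p] or prime to
[p]; the increments of a function along the orbit add up to zero, while relative
to their size they agree modulo something smaller than [p], so they vanish.

Global part.  The locus where the forms of [phi^n] are proportional to the
coordinates is closed, so when it contains infinitely many points of [C] it is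
[C] ([infinite_dense_form], by noetherianity and dimension 1).  The forms of
[phi^n] do not vanish identically on [C], because [phi] is injective on the
infinitely many fixed points ([iter_subst_neq0]).  Hence [phi^n] is the identity
of [C], the pullback by [phi] is onto the function field, and [phi] has degree 1
([morphism_degree_le1]). *)

(** * Non-archimedean absolute values *)

Record nonarchimedean (R : realType) (K : fieldType) (v : K -> R) : Prop := {
  abs_ge0 : forall x, 0 <= v x;
  abs_eq0 : forall x, v x = 0 <-> x = 0;
  absM : forall x y, v (x * y) = v x * v y;
  abs_ultra : forall x y, v (x + y) <= Num.max (v x) (v y)
}.

Lemma exprn_small (R : realType) (q d : R) :
  0 <= q -> q < 1 -> 0 < d -> exists k, q ^+ k < d.
Proof.
rewrite le_eqVlt => /predU1P[<-|q0] q1 d0; first by exists 1%N.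
pose h := q^-1 - 1; have h0 : 0 < h by rewrite subr_gt0 invf_gt1.
have bernoulli k : k%:R * h <= q^-1 ^+ k.
  elim: k => [|k IH]; first by rewrite mul0r.
  have -> : q^-1 ^+ k.+1 = q^-1 ^+ k + h * q^-1 ^+ k by rewrite exprS /h; ring.
  rewrite -natr1 mulrDl mul1r lerD // ler_peMr ?(ltW h0) // exprn_ege1 // ltW //.
  by rewrite invf_gt1.
have dh0 : 0 <= (d * h)^-1 by rewrite invr_ge0 mulr_ge0 // ltW.
exists (Num.bound (d * h)^-1); set k := Num.bound _.
have hk : (d * h)^-1 < k%:R by exact: archi_boundP.
rewrite -ltf_pV2 ?posrE ?exprn_gt0 // -exprVn (lt_le_trans _ (bernoulli k)) //.
by move: hk; rewrite invfM -ltr_pdivrMr.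
Qed.

Section NonArchimedean.
Variables (R : realType) (K : fieldType) (v : K -> R).
Hypothesis vP : nonarchimedean v.

Lemma abs0 : v 0 = 0. Proof. exact/(abs_eq0 vP). Qed.

Lemma abs_gt0 x : x != 0 -> 0 < v x.
Proof.
move=> x0; rewrite lt_neqAle (abs_ge0 vP) andbT eq_sym.
by apply: contra x0 => /eqP/(abs_eq0 vP)/eqP.
Qed.

Lemma abs1 : v 1 = 1.
Proof.
apply: (mulfI (lt0r_neq0 (abs_gt0 (oner_neq0 K)))).
by rewrite -(absM vP) !mulr1.
Qed.

Lemma absX x n : v (x ^+ n) = v x ^+ n.
Proof. by elim: n => [|n IH]; rewrite ?abs1// !exprS (absM vP) IH. Qed.

Lemma absN x : v (- x) = v x.
Proof.
have h : v (-1) = 1.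
  apply/eqP; rewrite -(@eqrXn2 _ 2) ?(abs_ge0 vP)// -absX.
  by rewrite sqrrN expr1n abs1 expr1n.
by rewrite -mulN1r (absM vP) h mul1r.
Qed.

Lemma absV x : v x^-1 = (v x)^-1.
Proof.
have [->|x0] := eqVneq x 0; first by rewrite invr0 abs0 invr0.
apply: (mulfI (lt0r_neq0 (abs_gt0 x0))).
by rewrite -(absM vP) divff // abs1 divff // lt0r_neq0 // abs_gt0.
Qed.

Lemma absD_le c x y : v x <= c -> v y <= c -> v (x + y) <= c.
Proof. by move=> hx hy; rewrite (le_trans (abs_ultra vP x y)) // ge_max hx. Qed.

Lemma absB_le c x y : v x <= c -> v y <= c -> v (x - y) <= c.
Proof. by move=> hx hy; apply: absD_le; rewrite ?absN. Qed.

Lemma absD_lt c x y : v x < c -> v y < c -> v (x + y) < c.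
Proof.
by move=> hx hy; rewrite (le_lt_trans (abs_ultra vP x y)) // gt_max hx.
Qed.

Lemma absB_lt c x y : v x < c -> v y < c -> v (x - y) < c.
Proof. by move=> hx hy; apply: absD_lt; rewrite ?absN. Qed.

Lemma abs_sum_le c (I : Type) (s : seq I) (P : pred I) (F : I -> K) :
  0 <= c -> (forall i, P i -> v (F i) <= c) -> v (\sum_(i <- s | P i) F i) <= c.
Proof.
move=> c0 h; apply: (big_ind (fun x => v x <= c)) => //; first by rewrite abs0.
by move=> x y; apply: absD_le.
Qed.

Lemma absM_le1 x y : v x <= 1 -> v y <= 1 -> v (x * y) <= 1.
Proof. by move=> hx hy; rewrite (absM vP) mulr_ile1 ?(abs_ge0 vP). Qed.

Lemma abs_nat_le1 n : v n%:R <= 1.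
Proof.
elim: n => [|n IH]; first by rewrite abs0.
by rewrite -natr1 absD_le // abs1.
Qed.

Lemma abs_int_le1 z : v z%:~R <= 1.
Proof. by case: z => n; rewrite ?NegzE ?mulrNz ?absN abs_nat_le1. Qed.

Lemma abs_near x y : v (x - y) < v y -> v x = v y.
Proof.
move=> h; apply/le_anti; rewrite -{1}[x](subrK y) absD_le //=; last exact: ltW.
rewrite leNgt; apply/negP => h2.
have := absB_lt h2 h; rewrite opprB addrC subrK ltxx //.
Qed.

Lemma absM_lt1 x y : v x <= 1 -> v y < 1 -> v (x * y) < 1.
Proof.
move=> hx hy; rewrite (absM vP) (le_lt_trans _ hy) //.
by rewrite ler_piMl ?(abs_ge0 vP).
Qed.

(** By Bezout, the integers prime to [p] are units of the valuation ring. *)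
Lemma abs_coprime p n :
  v p%:R < 1 -> (0 < p)%N -> coprime p n -> v n%:R = 1.
Proof.
move=> hp p0 cop; apply/le_anti; rewrite abs_nat_le1 leNgt; apply/negP => hn.
have [a b e _] := egcdnP n p0.
have := absB_lt (c := 1) (x := a%:R * p%:R) (y := b%:R * n%:R).
rewrite !absM_lt1 ?abs_nat_le1 // => /(_ isT isT).
by rewrite -!natrM e natrD (eqP cop) addrAC subrr add0r abs1 ltxx.
Qed.

(** * Rigidity of bijections congruent to the identity *)

Section Rigidity.
Variables (T I : Type) (f g : T -> T) (w : I -> T -> K).
Hypotheses (fK : cancel f g) (gK : cancel g f).
Hypothesis w_int : forall i y, v (w i y) <= 1.

(** The least algebra of functions over the valuation ring that contains the
coordinates and the inverses of functions with unit values, and that is stable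
under [f] and [g].  Stability under [g] allows a point to be replaced by its
preimage in congruences. *)
Inductive integral_fun : (T -> K) -> Prop :=
| integral_coord i : integral_fun (w i)
| integral_cst c : v c <= 1 -> integral_fun (fun=> c)
| integralD u1 u2 : integral_fun u1 -> integral_fun u2 ->
    integral_fun (fun y => u1 y + u2 y)
| integralM u1 u2 : integral_fun u1 -> integral_fun u2 ->
    integral_fun (fun y => u1 y * u2 y)
| integralV u : integral_fun u -> (forall y, v (u y) = 1) ->
    integral_fun (fun y => (u y)^-1)
| integral_f u : integral_fun u -> integral_fun (fun y => u (f y))
| integral_g u : integral_fun u -> integral_fun (fun y => u (g y)).

Lemma integral_le1 u : integral_fun u -> forall y, v (u y) <= 1.
Proof.
elim=> {u} [i|c hc|u1 u2 _ h1 _ h2|u1 u2 _ h1 _ h2|u _ _ h|u _ h|u _ h] y //.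
- exact: absD_le.
- exact: absM_le1.
- by rewrite absV h invr1.
Qed.

Lemma integral_ext u1 u2 : u1 =1 u2 -> integral_fun u1 -> integral_fun u2.
Proof. by move=> /funext ->. Qed.

Lemma integralN u : integral_fun u -> integral_fun (fun y => - u y).
Proof.
move=> h; apply: integral_ext (fun y => mulN1r (u y)) _.
by apply: integralM h; apply: integral_cst; rewrite absN abs1.
Qed.

Lemma integral_sum (J : Type) (s : seq J) (F : J -> T -> K) :
  (forall j, integral_fun (F j)) -> integral_fun (fun y => \sum_(j <- s) F j y).
Proof.
move=> h; elim: s => [|j s IH].
  apply: integral_ext (fun y => esym (big_nil _ _ _ _)) _.
  by apply: integral_cst; rewrite abs0 ler01.
by apply: integral_ext (fun y => esym (big_cons _ _ _ _ _ _)) _; apply: integralD.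
Qed.

(** [h] induces the identity on the integral functions modulo [c]. *)
Definition trivial_mod (c : K) (h : T -> T) := forall u, integral_fun u ->
  exists2 u', integral_fun u' & forall y, u (h y) = u y + c * u' y.

(** The functions [u] for which the conclusion holds form an algebra stable under
[f] and [g], so that it is enough to look at the generators. *)
Lemma trivial_mod_coord c h :
  v c < 1 -> (forall y, h (f y) = f (h y)) ->
  (forall i, exists2 u', integral_fun u' &
     forall y, w i (h y) = w i y + c * u' y) ->
  trivial_mod c h.
Proof.
move=> c1 hf hw.
have hg y : h (g y) = g (h y) by apply: (can_inj fK); rewrite -hf !gK.
move=> u; elim=> {u} [//|a _|u1 u2 _ [u1' i1 e1] _ [u2' i2 e2]
  |u1 u2 g1 [u1' i1 e1] g2 [u2' i2 e2]|u gu [u' i e] hu|u _ [u' i e]|u _ [u' i e]].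
- exists (fun=> 0); first by apply: integral_cst; rewrite abs0 ler01.
  by move=> y; rewrite mulr0 addr0.
- exists (fun y => u1' y + u2' y); first exact: integralD.
  by move=> y; rewrite e1 e2; ring.
- exists (fun y => (u1 y + c * u1' y) * u2' y + u1' y * u2 y).
    have ci : integral_fun (fun=> c) by apply: integral_cst; exact: ltW.
    by do ?[exact: integralM | apply: integralD | apply: integralM].
  by move=> y; rewrite e1 e2; ring.
- have ci : integral_fun (fun=> c) by apply: integral_cst; exact: ltW.
  have ui : integral_fun (fun y => u y + c * u' y).
    by apply: integralD => //; apply: integralM.
  have u1 y : v (u y + c * u' y) = 1 by rewrite -e hu.
  exists (fun y => - u' y * ((u y)^-1 * (u y + c * u' y)^-1)).
    apply: integralM; first exact: integralN.
    by apply: integralM; apply: integralV.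
  have nz z : v z = 1 -> z != 0.
    by move=> hz; apply: contra_eq_neq hz => ->; rewrite abs0 eq_sym oner_eq0.
  move=> y; rewrite e; have := nz _ (u1 y); have := nz _ (hu y) => n1 n2.
  by field; rewrite n1 n2.
- by exists (fun y => u' (f y)); [exact: integral_f|move=> y; rewrite -hf e].
- by exists (fun y => u' (g y)); [exact: integral_g|move=> y; rewrite -hg e].
Qed.

Lemma trivial_mod_comp c h u k :
  trivial_mod c h -> v c <= 1 -> integral_fun u ->
  integral_fun (fun y => u (iter k h y)).
Proof.
move=> ch c1; elim: k u => [|k IH] u iu //.
have [u' iu' e] := ch _ (IH _ iu).
apply: (@integral_ext (fun y => u (iter k h y) + c * u' y)).
  by move=> y; rewrite iterSr e.
by apply: integralD; [exact: IH|apply: integralM iu'; exact: integral_cst].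
Qed.

Lemma trivial_mod_iter c h k :
  trivial_mod c h -> v c <= 1 -> trivial_mod c (iter k h).
Proof.
move=> ch c1 u iu; have [u' iu' e] := ch _ iu.
exists (fun y => \sum_(0 <= i < k) u' (iter i h y)).
  by apply: integral_sum => i; apply: trivial_mod_comp ch c1 iu'.
move=> y; elim: k => [|k IH]; first by rewrite big_geq // mulr0 addr0.
by rewrite iterS e IH big_nat_recr //= mulrDr addrA.
Qed.

(** [u (h^p y) - u y] is the sum of the [p] increments [c * u' (h^i y)], each of
which is congruent to [c * u' y] modulo [c ^ 2]; both [c * p] and [c ^ 2] are
divisible by [b * c]. *)
Lemma trivial_mod_prime (b c : K) p h :
  v b <= 1 -> v c <= v b -> b != 0 -> v p%:R <= v b ->
  trivial_mod c h -> trivial_mod (b * c) (iter p h).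
Proof.
move=> b1 cb b0 pb ch u iu; have c1 := le_trans cb b1.
have [u' iu' e] := ch _ iu.
have int_div x : v x <= v b -> integral_fun (fun=> x / b).
  move=> xb; apply: integral_cst; rewrite (absM vP) absV.
  by rewrite ler_pdivrMr ?abs_gt0 // mul1r.
(* all terms of the telescoping sum agree with the first one modulo [c ^ 2] *)
have ex k : exists2 s, integral_fun s & forall y,
    u (iter k h y) = u y + c * (k%:R * u' y + c * s y).
  elim: k => [|k [s is_ es]].
    exists (fun=> 0); first by apply: integral_cst; rewrite abs0 ler01.
    by move=> y /=; rewrite mul0r mulr0 !addr0 mulr0 addr0.
  have [r ir er] := trivial_mod_iter k ch c1 iu'.
  exists (fun y => s y + r y); first exact: integralD.
  by move=> y; rewrite iterS e es er -natr1; ring.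
have [s is_ es] := ex p.
exists (fun y => p%:R / b * u' y + c / b * s y).
  by apply: integralD; (apply: integralM; first exact: int_div).
by move=> y; rewrite es; field.
Qed.

Lemma trivial_mod_power (b : K) p h k :
  v b <= 1 -> b != 0 -> v p%:R <= v b ->
  trivial_mod b h -> trivial_mod (b ^+ k.+1) (iter (p ^ k) h).
Proof.
move=> b1 b0 pb bh; elim: k => [|k IH] //.
have -> : iter (p ^ k.+1) h = iter p (iter (p ^ k) h).
  by apply/funext => y; rewrite expnSr mulnC iterM.
rewrite exprS; apply: trivial_mod_prime => //.
by rewrite absX exprS ler_piMr ?(abs_ge0 vP) // exprn_ile1 ?(abs_ge0 vP).
Qed.

(** Adding the increments of [u] along the orbit of [y] gives
[0 = n (u (h y) - u y)] up to second increments, which are smaller than the first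
ones by the factor [c].  As [v c < v n], any bound for the first increments of
all the functions [u] can be multiplied by [v c / v n < 1], so they vanish. *)
Lemma trivial_mod_fixed_step (c : K) n h y :
  v c <= 1 -> v c < v n%:R -> trivial_mod c h ->
  (forall u, integral_fun u -> u (iter n h y) = u y) ->
  forall u, integral_fun u -> u (h y) = u y.
Proof.
move=> c1 cn ch hy.
have n0 : 0 < v n%:R by apply: le_lt_trans cn; exact: abs_ge0.
pose q := v c / v n%:R.
have q0 : 0 <= q by rewrite divr_ge0 ?(abs_ge0 vP).
have q1 : q < 1 by rewrite ltr_pdivrMr // mul1r.
have step d : 0 <= d ->
    (forall u, integral_fun u -> v (u (h y) - u y) <= d) ->
    forall u, integral_fun u -> v (u (h y) - u y) <= q * d.
  move=> d0 hd u iu; have [u' iu' e] := ch _ iu.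
  have incr k : v (u' (iter k h y) - u' y) <= d.
    elim: k => [|k IH]; first by rewrite subrr abs0.
    rewrite -[_ - u' y](subrKA (u' (iter k h y))) addrC; apply: absD_le => //.
    by rewrite iterSr; apply: (hd (fun z => u' (iter k h z)));
       apply: trivial_mod_comp ch c1 iu'.
  have tele k : u (iter k h y) - u y
      = k%:R * (u (h y) - u y) + c * \sum_(i < k) (u' (iter i h y) - u' y).
    elim: k => [|k IH]; first by rewrite big_ord0 mulr0 mul0r addr0 subrr.
    rewrite iterS e big_ord_recr /= -natr1 e.
    have -> : u (iter k h y) = u y + (u (iter k h y) - u y) by rewrite addrC subrK.
    by rewrite IH e; ring.
  have := tele n; rewrite hy // subrr => /esym/eqP; rewrite addr_eq0 => /eqP en.
  rewrite mulrAC ler_pdivlMr // mulrC -(absM vP) en absN (absM vP).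
  by rewrite ler_wpM2l ?(abs_ge0 vP)// abs_sum_le.
have bound k u : integral_fun u -> v (u (h y) - u y) <= q ^+ k.
  elim: k u => [|k IH] u iu; first by rewrite absB_le ?integral_le1.
  by rewrite exprS; apply: step => //; rewrite exprn_ge0.
move=> u iu; apply/eqP; rewrite -subr_eq0; apply/eqP/(abs_eq0 vP)/le_anti.
rewrite (abs_ge0 vP) andbT leNgt; apply/negP => dpos.
have [k hk] : exists k, q ^+ k < v (u (h y) - u y) by exact: exprn_small.
by have := lt_le_trans hk (bound k u iu); rewrite ltxx.
Qed.

(** The factors [p] of the period are removed one at a time, passing to [h^p];
what remains is prime to [p], hence a unit. *)
Lemma trivial_mod_fixed (c : K) p n h y :
  prime p -> v p%:R < 1 -> v c < v p%:R -> (0 < n)%N -> trivial_mod c h ->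
  (forall u, integral_fun u -> u (iter n h y) = u y) ->
  forall u, integral_fun u -> u (h y) = u y.
Proof.
move=> pp p1 cp; have c1 : v c <= 1 by rewrite ltW // (lt_trans cp).
elim/ltn_ind: n h => n IH h n0 ch hy.
have [/dvdnP[m nE]|ndiv] := boolP (p %| n)%N; last first.
  apply: (trivial_mod_fixed_step _ _ ch hy) => //.
  rewrite (abs_coprime p1 (prime_gt0 pp)) ?prime_coprime //.
  exact: lt_trans cp p1.
apply: (trivial_mod_fixed_step c1 cp ch).
have m0 : (0 < m)%N by move: n0; rewrite nE muln_gt0 => /andP[].
apply: (IH m); rewrite ?nE ?ltn_Pmulr ?prime_gt1 //.
  exact: trivial_mod_iter.
by move=> u iu; rewrite -iterM -nE hy.
Qed.

End Rigidity.

(** * Bijections with a linear part over the valuation ring *)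

Section LinearPart.
Variables (T : Type) (N : nat) (f g : T -> T) (w : 'I_N.+1 -> T -> K).
Hypotheses (fK : cancel f g) (gK : cancel g f).
Hypothesis w_int : forall i y, v (w i y) <= 1.
Notation integral_fun := (integral_fun f g w).

Let W y : 'cV[K]_N.+1 := \col_i w i y.

Definition linear_mod (b : K) (A : 'M[K]_N.+1) (h : T -> T) :=
  exists2 k : 'I_N.+1 -> T -> K, forall i, integral_fun (k i) &
    forall y, W (h y) = A *m W y + b *: \col_i k i y.

Lemma integral_mulmx (A : 'M[K]_N.+1) (k : 'I_N.+1 -> T -> K) i :
  (forall i j, v (A i j) <= 1) -> (forall i, integral_fun (k i)) ->
  integral_fun (fun y => (A *m \col_i k i y) i 0).
Proof.
move=> hA hk.
apply: (@integral_ext _ _ _ _ _ (fun y => \sum_j A i j * k j y)).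
  by move=> y; rewrite mxE; apply: eq_bigr => j _; rewrite mxE.
by apply: integral_sum => j; apply: integralM (hk j); apply: integral_cst.
Qed.

Lemma mulmx_le1 (A B : 'M[K]_N.+1) :
  (forall i j, v (A i j) <= 1) -> (forall i j, v (B i j) <= 1) ->
  forall i j, v ((A * B) i j) <= 1.
Proof.
move=> hA hB i j; rewrite mxE; apply: abs_sum_le => // k _.
exact: absM_le1.
Qed.

Lemma expmx_le1 (A : 'M[K]_N.+1) n :
  (forall i j, v (A i j) <= 1) -> forall i j, v ((A ^+ n) i j) <= 1.
Proof.
move=> hA; elim: n => [|n IH] i j; last by rewrite exprS; apply: mulmx_le1.
by rewrite !mxE; case: eqP; rewrite /= ?mulr1n ?abs1 ?mulr0n ?abs0.
Qed.

Lemma linear_mod_iter b (A : 'M[K]_N.+1) n : (forall i j, v (A i j) <= 1) ->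
  linear_mod b A f -> linear_mod b (A ^+ n) (iter n f).
Proof.
move=> hA [k ik ek]; elim: n => [|n [k' ik' ek']].
  exists (fun _ _ => 0).
    by move=> i; apply: integral_cst; rewrite abs0 ler01.
  move=> y; rewrite expr0 mul1mx; apply/matrixP => i j.
  by rewrite !mxE mulr0 addr0.
exists (fun i y => (A ^+ n *m \col_i k i y) i 0 + k' i (f y)).
  move=> i; apply: integralD; last exact: integral_f.
  by apply: integral_mulmx => // *; apply: expmx_le1.
move=> y; rewrite iterSr ek' ek mulmxDr mulmxA exprSr -addrA; congr (_ + _).
by rewrite -scalemxAr -scalerDr; congr (_ *: _); apply/matrixP => i j;
   rewrite !mxE !ord1; congr (_ + _); rewrite !mxE.
Qed.

(** As [y = h z] for [h := iter n f] and [z := iter n g y], both [W y] and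
[W (h y)] are congruent to linear functions of [W z], with the matrices [A] and
[A * A], which agree modulo [b]. *)
Lemma linear_mod_idem b (A : 'M[K]_N.+1) n :
  (forall i j, v (A i j) <= 1) -> b != 0 -> v b < 1 ->
  (forall i j, v ((A * A - A) i j) <= v b) ->
  linear_mod b A (iter n f) -> trivial_mod f g w b (iter n f).
Proof.
move=> hA b0 b1 idA [k ik ek]; apply: trivial_mod_coord => //.
  by move=> y; rewrite -iterS -iterSr.
have fgn y : iter n f (iter n g y) = y.
  by elim: n {ek} y => [|n IH] // y; rewrite iterSr iterS gK IH.
move=> i; pose z y := iter n g y.
have iz u : integral_fun u -> integral_fun (fun y => u (z y)).
  rewrite /z; elim: n {ek fgn z} u => [//|n IH] u iu.
  apply: (@integral_ext _ _ _ _ _ (fun y => u (g (iter n g y)))) => //.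
  by apply: (IH (fun y => u (g y))); apply: integral_g.
pose D : 'M[K]_N.+1 := b^-1 *: (A * A - A).
have hD j l : v (D j l) <= 1.
  rewrite mxE (absM vP) absV mulrC ler_pdivrMr ?abs_gt0 // mul1r.
  exact: idA.
exists (fun y => (D *m W (z y)) i 0 + (A *m \col_i k i (z y)) i 0
                 - k i (z y) + k i y).
  apply: integralD => //; apply: integralD; last first.
    by apply: integralN; apply: iz.
  apply: integralD.
    apply: (iz (fun y => (D *m W y) i 0)); apply: integral_mulmx => // j.
    exact: integral_coord.
  by apply: (iz (fun y => (A *m \col_i k i y) i 0)); apply: integral_mulmx.
move=> y; have := ek y; have := ek (z y); rewrite fgn => e1 e2.
have -> : w i (iter n f y) = W (iter n f y) i 0 by rewrite mxE.
have -> : w i y = W y i 0 by rewrite mxE.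
have bD : b *: D = A * A - A by rewrite scalerA divff // scale1r.
have -> : W (iter n f y) = W y + b *: (D *m W (z y) + A *m \col_i k i (z y)
                 - \col_i k i (z y) + \col_i k i y).
  rewrite !scalerDr scalerN scalemxAl bD e2 e1 mulmxDr mulmxA mulmxBl.
  rewrite -[A *m A]/(A * A) -scalemxAr -!addrA.
  set X := A * A *m _; set Y := A *m W _; set Z := b *: (A *m _).
  set P := b *: _; set Q := b *: _.
  by apply/matrixP => ii jj; rewrite !mxE; ring.
by rewrite !mxE.
Qed.

Lemma periodic_common_period b (A : 'M[K]_N.+1) n p :
  (forall y y', (forall i, w i y = w i y') -> y = y') ->
  prime p -> v p%:R < 1 -> p%:R != 0 :> K ->
  b != 0 -> v b < 1 -> v p%:R <= v b ->
  (forall i j, v (A i j) <= 1) -> (0 < n)%N ->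
  (forall i j, v ((A ^+ n * A ^+ n - A ^+ n) i j) <= v b) ->
  linear_mod b A f ->
  exists2 m, (0 < m)%N & forall y k, (0 < k)%N -> iter k f y = y ->
    iter m f y = y.
Proof.
move=> w_inj pp p1 p0 b0 b1 pb hA n0 idA fA.
have tb : trivial_mod f g w b (iter n f).
  apply: (linear_mod_idem (expmx_le1 n hA)) => //; exact: linear_mod_iter.
have [s hs] := exprn_small (abs_ge0 vP b) b1 (abs_gt0 p0).
have tc := trivial_mod_power s (ltW b1) b0 pb tb.
exists (p ^ s * n)%N; first by rewrite muln_gt0 expn_gt0 prime_gt0.
move=> y k k0 hy; apply: w_inj => i; rewrite iterM.
apply: (trivial_mod_fixed w_int pp p1 _ k0 tc); last exact: integral_coord.
  rewrite absX exprS (le_lt_trans _ hs) // ler_piMl ?exprn_ge0 ?(abs_ge0 vP) //.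
  exact: ltW.
move=> u _; congr u.
have -> : iter k (iter (p ^ s) (iter n f)) y = iter (p ^ s * n) (iter k f) y.
  by rewrite -!iterM; congr iter; rewrite [RHS]mulnC mulnA.
by elim: (p ^ s * n)%N => //= q ->.
Qed.

End LinearPart.
End NonArchimedean.

(** * Powers of matrices over an algebraic extension of a prime field *)

(** The powers [a ^+ (p ^ i)] are all roots of [q], hence two of them agree, and
the Frobenius map is injective. *)
Lemma frobenius_periodic (k : fieldType) p (q : {poly k}) (a : k) :
  p \in [pchar k] -> q != 0 -> (forall i, q`_i ^+ p = q`_i) -> root q a ->
  exists2 l, (0 < l)%N & a ^+ (p ^ l) = a.
Proof.
move=> chp q0 qp qa; pose Fr : {rmorphism k -> k} := pFrobenius_aut chp.
have FrE x : Fr x = x ^+ p by [].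
have qFr : map_poly Fr q = q.
  by apply/polyP => i; rewrite coef_map /= pFrobenius_autE qp.
have rt i : root q (a ^+ (p ^ i)).
  elim: i => [|i IH]; first by rewrite expn0 expr1.
  rewrite expnSr exprM -FrE -qFr /root horner_map; move/rootP: IH => ->.
  by rewrite rmorph0.
have Fr_inj i (x y : k) : x ^+ (p ^ i) = y ^+ (p ^ i) -> x = y.
  elim: i => [|i IH]; first by rewrite !expr1.
  by rewrite expnSr !exprM => e; apply: IH; exact: (fmorph_inj Fr e).
pose s := [seq a ^+ (p ^ i) | i <- iota 0 (size q)].
have [i [j [ij js]]] : exists i j, [/\ (i < j)%N, (j < size s)%N &
    nth 0 s i = nth 0 s j].
  apply/uniqPn; apply/negP => us.
  have rs : all (root q) s by apply/allP => _ /mapP[i _ ->].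
  by have := max_poly_roots q0 rs us; rewrite size_map size_iota ltnn.
rewrite size_map size_iota in js.
rewrite !(nth_map 0%N) ?size_iota ?(ltn_trans ij js) // !nth_iota //;
  last exact: ltn_trans js.
rewrite !add0n => e; exists (j - i)%N; first by rewrite subn_gt0.
by apply: (Fr_inj i); rewrite -exprM -expnD subnK ?(ltnW ij).
Qed.

(** The entries of all powers of [A] lie in a finite field, so the powers of [A]
repeat; a large enough multiple of the period is the exponent. *)
Lemma expmx_idempotent (k : closedFieldType) p N (A : 'M[k]_N.+1) :
  p \in [pchar k] ->
  (forall a : k, exists2 l, (0 < l)%N & a ^+ (p ^ l) = a) ->
  exists2 n, (0 < n)%N & A ^+ n * A ^+ n = A ^+ n.
Proof.
move=> chp hk.
have frobM (a : k) l m : a ^+ (p ^ l) = a -> a ^+ (p ^ (l * m)) = a.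
  by move=> h; elim: m => [|m IH]; rewrite ?muln0 ?expr1// mulnS expnD exprM h.
have [l l0 hl] : exists2 l, (0 < l)%N & forall i j, A i j ^+ (p ^ l) = A i j.
  have [d hd] : {d : k -> nat &
      forall a, (0 < d a)%N /\ a ^+ (p ^ d a) = a}.
    apply: (@choice k nat (fun a l => (0 < l)%N /\ a ^+ (p ^ l) = a)) => a.
    by have [l] := hk a; exists l.
  exists (\prod_(ij : 'I_N.+1 * 'I_N.+1) d (A ij.1 ij.2))%N.
    by rewrite prodn_gt0 // => ij; have [] := hd (A ij.1 ij.2).
  move=> i j; rewrite (bigD1 (i, j)) //= frobM //; by have [] := hd (A i j).
(* the finite subfield with [p ^ l] elements *)
pose S (x : k) := x ^+ (p ^ l) = x.
have S_sum (J : finType) (F : J -> k) :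
    (forall j, S (F j)) -> S (\sum_j F j).
  move=> hF; apply: (big_ind S) => //.
    by rewrite /S expr0n expn_eq0 -leqn0 leqNgt prime_gt0 ?(pcharf_prime chp).
  move=> x y hx hy; rewrite /S exprDn_pchar ?hx ?hy //.
  by rewrite (eq_pnat _ (pcharf_eq chp)) pnatX pnat_id ?(pcharf_prime chp).
have SA n i j : S ((A ^+ n) i j).
  elim: n i j => [|n IH] i j; last first.
    by rewrite exprS mxE; apply: S_sum => m; rewrite /S exprMn hl IH.
  rewrite !mxE; case: eqP => _; first by rewrite /S expr1n.
  by rewrite /S expr0n expn_eq0 -leqn0 leqNgt prime_gt0 ?(pcharf_prime chp).
have pl1 : (1 < p ^ l)%N.
  by rewrite -(exp1n l) ltn_exp2r // prime_gt1 ?(pcharf_prime chp).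
pose q : {poly k} := 'X^(p ^ l) - 'X.
have q0 : q != 0.
  by rewrite -size_poly_eq0 /q size_polyDl ?size_polyN ?size_polyX size_polyXn.
have [s sE] := closed_field_poly_normal q.
have Ss x : S x -> x \in s.
  move=> Sx; rewrite -root_prod_XsubC.
  have : root q x by rewrite /root !hornerE Sx subrr.
  by rewrite sE rootZ // lead_coef_eq0.
pose F (n : 'I_(#|{ffun 'I_N.+1 * 'I_N.+1 -> 'I_(size s).+1}|.+1)) :
    {ffun 'I_N.+1 * 'I_N.+1 -> 'I_(size s).+1} :=
  [ffun ij => inord (index ((A ^+ n) ij.1 ij.2) s)].
have nF : ~ injective F.
  by move=> /leq_card; rewrite card_ord ltnn.
have [i [j ij eij]] : exists i, exists2 j, (i < j)%N & A ^+ i = A ^+ j.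
  move: nF => /existsNP[i /existsNP[j /not_implyP[eF ij]]].
  have eA : A ^+ i = A ^+ j.
    apply/matrixP => a b; move/ffunP/(_ (a, b)): eF; rewrite !ffunE /=.
    move=> /(congr1 (@nat_of_ord _)); rewrite !inordK ?ltnS ?index_size // => e.
    by rewrite -(nth_index 0 (Ss _ (SA i a b))) e nth_index // Ss.
  case: (ltngtP i j) => [lt|lt|/val_inj//]; first by exists i; exists j.
  by exists j; exists i.
(* from [i] on the powers of [A] have period [d]; the exponent [d * i.+1] is a
   multiple of [d] beyond [i] *)
pose d := (j - i)%N.
have per t m : (i <= t)%N -> A ^+ (t + d * m) = A ^+ t.
  move=> it; elim: m => [|m IH]; first by rewrite muln0 addn0.
  have -> : (t + d * m.+1 = t - i + d * m + j)%N by rewrite /d; lia.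
  by rewrite exprD -eij -exprD -IH; congr (_ ^+ _); lia.
have d0 : (0 < d)%N by rewrite subn_gt0.
exists (d * i.+1)%N; first by rewrite muln_gt0 d0.
rewrite -exprD per // (leq_trans (leqnSn i)) //; exact: leq_pmull.
Qed.

(** * Reduction and the residue field *)

Section Reduction.
Variables (R : realType) (K k : fieldType) (v : K -> R) (red : K -> k).
Hypotheses (vP : nonarchimedean v) (redP : is_reduction v red).

Lemma red0 : red 0 = 0.
Proof. by apply/(red_eq0 redP); rewrite ?inE abs0 ?ler01 ?ltr01. Qed.

Lemma redN x : v x <= 1 -> red (- x) = - red x.
Proof.
move=> x1; apply/eqP; rewrite -addr_eq0 -(redD redP) ?inE ?absN //.
by rewrite addNr red0.
Qed.

Lemma redB x y : v x <= 1 -> v y <= 1 -> red (x - y) = red x - red y.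
Proof. by move=> hx hy; rewrite (redD redP) ?inE ?absN // redN. Qed.

Lemma red_neq0 x : v x <= 1 -> (red x != 0) = (v x == 1).
Proof.
move=> x1; have [e|n] := boolP (v x == 1).
  by apply/negP => /eqP/(red_eq0 redP); rewrite inE x1 (eqP e) ltxx => /(_ isT).
apply/negbTE; rewrite negbK; apply/eqP/(red_eq0 redP); rewrite ?inE //.
by rewrite lt_neqAle n.
Qed.

Lemma red_nat n : red n%:R = n%:R.
Proof.
elim: n => [|n IH]; first exact: red0.
by rewrite -!natr1 (redD redP) ?inE ?abs1 ?abs_nat_le1 // IH (red1 redP).
Qed.

Lemma red_int z : red z%:~R = z%:~R.
Proof.
case: z => n; first exact: red_nat.
by rewrite NegzE !mulrNz redN ?abs_nat_le1 // red_nat.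
Qed.

Lemma red_sum (I : Type) (s : seq I) (P : pred I) (F : I -> K) :
  (forall i, P i -> v (F i) <= 1) ->
  red (\sum_(i <- s | P i) F i) = \sum_(i <- s | P i) red (F i).
Proof.
move=> h; suff [//] : red (\sum_(i <- s | P i) F i) = \sum_(i <- s | P i) red (F i)
  /\ v (\sum_(i <- s | P i) F i) <= 1.
apply: (big_rec2 (fun x y => red x = y /\ v x <= 1)).
  by rewrite red0 abs0.
move=> i y x Pi [<- hx]; rewrite (redD redP) ?inE ?h //; split => //.
by apply: absD_le; rewrite ?h.
Qed.

Lemma absX_le1 x n : v x <= 1 -> v (x ^+ n) <= 1.
Proof. by move=> hx; rewrite absX // exprn_ile1 ?(abs_ge0 vP). Qed.

Lemma redX x n : v x <= 1 -> red (x ^+ n) = red x ^+ n.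
Proof.
move=> x1; elim: n => [|n IH]; first by rewrite !expr0 (red1 redP).
by rewrite !exprS (redM redP) ?inE ?absX_le1 // IH.
Qed.

Lemma abs_prod_le1 (I : Type) (s : seq I) (F : I -> K) :
  (forall i, v (F i) <= 1) -> v (\prod_(i <- s) F i) <= 1.
Proof.
move=> h; apply: (big_ind (fun x => v x <= 1)) => //; first by rewrite abs1.
by move=> x y; apply: absM_le1.
Qed.

Lemma red_prod (I : Type) (s : seq I) (F : I -> K) :
  (forall i, v (F i) <= 1) ->
  red (\prod_(i <- s) F i) = \prod_(i <- s) red (F i).
Proof.
move=> h; elim: s => [|i s IH]; first by rewrite !big_nil (red1 redP).
by rewrite !big_cons (redM redP) ?inE ?abs_prod_le1 // IH.
Qed.

Lemma mpolyOver_coef n (F : {mpoly K[n]}) m :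
  F \is a mpolyOver n (Oint v) -> v F@_m <= 1.
Proof.
rewrite qualifE => /allP h; have [ms|] := boolP (m \in msupp F).
  by apply: (h F@_m); apply: map_f.
by rewrite -mcoeff_eq0 => /eqP ->; rewrite abs0.
Qed.

Lemma meval_map_red n (F : {mpoly K[n]}) (X : 'I_n -> K) :
  F \is a mpolyOver n (Oint v) -> (forall i, v (X i) <= 1) ->
  (map_mpoly red F).@[fun i => red (X i)] = red F.@[X].
Proof.
move=> FO hX; rewrite [in RHS]mevalE red_sum; last first.
  move=> m _; rewrite absM_le1 ?mpolyOver_coef // abs_prod_le1 // => i.
  exact: absX_le1.
rewrite /map_mpoly /mmap rmorph_sum /=; apply: eq_bigr => m _.
rewrite mevalM mevalC mmap1_id mevalX (redM redP) ?inE ?mpolyOver_coef //.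
  congr (_ * _); rewrite red_prod; last by move=> i; exact: absX_le1.
  by apply: eq_bigr => i _; rewrite redX.
by rewrite abs_prod_le1 // => i; exact: absX_le1.
Qed.

End Reduction.

Section ResidueField.
Variables (R : realType) (p : nat) (Qp : fieldType) (K k : closedFieldType).
Variables (emb : {rmorphism Qp -> K}) (v : K -> R) (red : K -> k).
Hypotheses (p_prime : prime p) (padic : is_padic_closure p emb v).
Hypothesis redP : is_reduction v red.

Lemma padic_nonarchimedean : nonarchimedean v.
Proof. by case: padic. Qed.
Let vP := padic_nonarchimedean.

Lemma abs_p_gt0 : 0 < v p%:R.
Proof. by rewrite (pabs_p padic) invr_gt0 ltr0n prime_gt0. Qed.

Lemma abs_p_lt1 : v p%:R < 1.
Proof. by rewrite (pabs_p padic) invf_lt1 ?ltr1n ?ltr0n ?prime_gt0 ?prime_gt1. Qed.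

Lemma p_neq0 : p%:R != 0 :> K.
Proof. by apply/eqP => /(pabs_eq0 padic) e; have := abs_p_gt0; rewrite e ltxx. Qed.

Lemma pchar_residue : p \in [pchar k].
Proof.
apply/andP; split => //; rewrite -(red_nat vP redP) -[_ == 0]negbK.
by rewrite (red_neq0 redP) ?ltW ?abs_p_lt1 // lt_eqF ?abs_p_lt1.
Qed.

(** An element of [Qp] of absolute value at most 1 is congruent to a rational
number whose denominator is prime to [p], hence to an element of the prime
field. *)
Lemma frobenius_red_Qp (c : Qp) :
  v (emb c) <= 1 -> red (emb c) ^+ p = red (emb c).
Proof.
move=> c1; have [q hq] := rat_dense padic c ltr01.
pose x := emb (ratr q).
have x1 : v x <= 1.
  by rewrite -[x](subKr (emb c)) absB_le // -rmorphB ltW.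
have -> : red (emb c) = red x.
  apply/eqP; rewrite -subr_eq0 -(redB vP) //; apply/eqP/(red_eq0 redP).
    by rewrite inE -rmorphB ltW.
  by rewrite -rmorphB.
pose a : K := (numq q)%:~R; pose b : K := (denq q)%:~R.
have xE : x = a / b by rewrite /x /ratr fmorph_div !rmorph_int.
have [b0|b0] := eqVneq b 0.
  by rewrite xE b0 invr0 mulr0 (red0 vP redP) expr0n -leqn0 leqNgt prime_gt0.
have xb : x * b = a by rewrite xE divfK.
have b1 : v b = 1.
  apply/le_anti; rewrite abs_int_le1 //= leNgt; apply/negP => hb.
  have ha : v a < 1 by rewrite -xb absM_lt1.
  have := coprime_num_den q; rewrite -coprimezE => /coprimezP[[s t] /= e].
  have := absD_lt vP (absM_lt1 vP (abs_int_le1 vP s) ha)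
                     (absM_lt1 vP (abs_int_le1 vP t) hb).
  by rewrite -!intrM -intrD e abs1 // ltxx.
have rb : red b != 0 by rewrite (red_neq0 redP) ?b1.
have -> : red x = red a / red b.
  by rewrite -xb (redM redP) ?inE ?b1 // mulfK.
rewrite !(red_int vP redP) expr_div_n.
by rewrite -!(pFrobenius_autE pchar_residue) !pFrobenius_aut_int.
Qed.

(** Every residue class is algebraic over the prime field: the relation over
[Qp] satisfied by a lift is divided by its largest coefficient and reduced. *)
Lemma residue_frobenius_periodic (a : k) :
  exists2 l, (0 < l)%N & a ^+ (p ^ l) = a.
Proof.
have [x x1 <-] := red_surj redP a; rewrite inE in x1.
have [q q0 qx] := closure_algebraic padic x.
have q_gt0 : (0 < size q)%N by rewrite size_poly_gt0.
pose i0 := [arg max_(i > Ordinal q_gt0) v (emb q`_i)]%O.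
have hmax i : v (emb q`_i) <= v (emb q`_i0).
  rewrite /i0; case: arg_maxP => // j _ hj; have [iq|iq] := ltnP i (size q).
    exact: (hj (Ordinal iq)).
  by rewrite nth_default // rmorph0 abs0 // (abs_ge0 vP).
pose c := q`_i0; have c0 : c != 0.
  apply: contraNneq q0 => c0; apply/eqP/polyP => i; rewrite coef0.
  have := hmax i; rewrite -/c c0 rmorph0 abs0 // => h.
  apply/eqP; rewrite -(fmorph_eq0 emb); apply/eqP/(pabs_eq0 padic)/le_anti.
  by rewrite h (abs_ge0 vP).
pose q' := c^-1 *: q.
have q'1 i : v (emb q'`_i) <= 1.
  rewrite coefZ rmorphM (absM vP) fmorphV absV // mulrC.
  by rewrite ler_pdivrMr ?mul1r ?hmax // abs_gt0 // fmorph_eq0.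
pose qb := \poly_(i < size q') red (emb q'`_i).
have qbE i : qb`_i = red (emb q'`_i).
  rewrite coef_poly; case: ltnP => // h.
  by rewrite nth_default // rmorph0 (red0 vP redP).
apply: (frobenius_periodic (q := qb) pchar_residue).
- apply/eqP => /polyP/(_ i0); rewrite qbE coefZ mulVf // rmorph1 (red1 redP).
  by rewrite coef0 => /eqP; rewrite oner_eq0.
- by move=> i; rewrite qbE frobenius_red_Qp.
- rewrite /root horner_poly.
  have : root (map_poly emb q') x by rewrite map_polyZ rootZ // fmorph_eq0 invr_eq0.
  rewrite /root horner_coef size_map_poly => /eqP e.
  rewrite -[X in _ == X](red0 vP redP) -[in X in _ == X]e (red_sum vP redP).
    apply/eqP; apply: eq_bigr => i _; rewrite coef_map.
    by rewrite -(redX vP redP) // -(redM redP) ?inE ?absX_le1.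
  move=> i _; rewrite coef_map; apply: absM_le1 => //.
    exact: q'1.
  exact: absX_le1.
Qed.

Lemma idempotent_mod_maximal N (A : 'M[K]_N.+1) :
  (forall i j, v (A i j) <= 1) ->
  exists2 n, (0 < n)%N &
    forall i j, v ((A ^+ n * A ^+ n - A ^+ n) i j) < 1.
Proof.
move=> hA; have redMx (B C : 'M[K]_N.+1) :
    (forall i j, v (B i j) <= 1) -> (forall i j, v (C i j) <= 1) ->
    map_mx red (B * C) = map_mx red B * map_mx red C.
  move=> hB hC; apply/matrixP => i j; rewrite !mxE (red_sum vP redP).
    by apply: eq_bigr => m _; rewrite (redM redP) ?inE // !mxE.
  by move=> m _; rewrite absM_le1.
have redXx n : map_mx red (A ^+ n) = (map_mx red A) ^+ n.
  elim: n => [|n IH]; last by rewrite !exprS redMx ?IH // => *; apply: expmx_le1.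
  apply/matrixP => i j; rewrite !mxE; case: eqP => _.
    exact: red1 redP.
  exact: (red0 vP redP).
have [n n0 e] := expmx_idempotent (map_mx red A) pchar_residue
                   residue_frobenius_periodic.
have An := expmx_le1 vP n hA; have AAn := mulmx_le1 vP An An.
exists n => // i j; rewrite mxE [X in _ + X]mxE.
apply/(red_eq0 redP); first by rewrite inE absB_le.
rewrite (redB vP redP) //; apply/eqP; rewrite subr_eq0; apply/eqP.
have := congr1 (fun B : 'M_N.+1 => B i j) e.
by rewrite -redXx -redMx // !mxE.
Qed.

End ResidueField.

(** * Noetherianity *)

Lemma subsequence_nondecreasing (a : nat -> nat) : exists2 h : nat -> nat,
  {homo h : i j / (i < j)%N} & {homo (fun i => a (h i)) : i j / (i <= j)%N}.
Proof.
have ex n : exists j, (n <= j)%N /\ forall l, (n <= l)%N -> (a j <= a l)%N.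
  have hP : exists b, `[< exists2 j, (n <= j)%N & a j = b >].
    by exists (a n); apply/asboolP; exists n.
  have [b /asboolP[j nj <-] hb] := ex_minnP hP.
  by exists j; split => // l nl; apply: hb; apply/asboolP; exists l.
have [s hs] := @choice _ _ _ ex.
pose h := fix h i := if i is i'.+1 then s (h i').+1 else s 0%N.
exists h.
  by apply: homo_ltn; [exact: ltn_trans|move=> i /=; have [] := hs (h i).+1].
apply: homo_leq => // [|i /=]; first exact: leq_trans.
have min_h l : (h i <= l)%N -> (a (h i) <= a l)%N.
  case: i => [|i] /= hl; first by have [_] := hs 0%N; apply.
  by have [h1] := hs (h i).+1; apply; apply: leq_trans hl.
by apply: min_h; have [/ltnW] := hs (h i).+1.
Qed.

(** Dickson's lemma, by passing to subsequences along which one exponent after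
the other is nondecreasing. *)
Lemma dickson n (m : nat -> 'X_{1..n}) :
  exists i, exists2 j, (i < j)%N & (m i <= m j)%MM.
Proof.
have [h hh hm] : exists2 h : nat -> nat, {homo h : i j / (i < j)%N} &
    forall k, k \in enum 'I_n -> {homo (fun i => m (h i) k) : i j / (i <= j)%N}.
  elim: (enum 'I_n) => [|k s [h hh hm]]; first by exists id.
  have [h' hh' hm'] := subsequence_nondecreasing (fun i => m (h i) k).
  exists (h \o h') => [i j ij|l]; first exact/hh/hh'.
  rewrite inE => /predU1P[->|/hm hl] i j ij; first exact: hm'.
  apply: hl; move: ij; rewrite leq_eqVlt => /predU1P[->//|/hh'/ltnW //].
exists (h 0%N), (h 1%N); first exact: hh.
by apply/mnm_lepP => k; apply: hm; rewrite ?mem_enum.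
Qed.

(** Otherwise choose in each step of the chain a new element of least leading
monomial.  By Dickson's lemma an earlier leading monomial divides a later one,
and subtracting a multiple contradicts the choice. *)
Lemma ideal_chain_stationary (K : fieldType) n (J : nat -> set {mpoly K[n]}) :
  (forall i p q, J i p -> J i q -> J i (p + q)) ->
  (forall i p q, J i p -> J i (q * p)) -> (forall i, J i 0) ->
  (forall i, J i `<=` J i.+1) -> exists i, J i.+1 `<=` J i.
Proof.
move=> JD JM J0 Jinc; apply: contrapT => /forallNP noti.
have ex i : exists q, [/\ J i.+1 q, ~ J i q &
    forall q', J i.+1 q' -> ~ J i q' -> (mlead q <= mlead q')%O].
  apply: contrapT => h; apply: (noti i) => q; apply: contraPP.
  elim/mleadrect: q => q IH Jq nq; apply: h; exists q; split => // q' Jq' nq'.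
  by rewrite leNgt; apply/negP => /IH; exact.
have [q hq] := @choice _ _ _ ex.
have mono i j : (i <= j)%N -> J i `<=` J j.
  by move=> /subnK <-; elim: (j - i)%N => // l IH y /IH /Jinc.
have [i [j ij le]] := dickson (fun i => mlead (q i)).
have [Ji _ _] := hq i; have [Jj nJj minj] := hq j.
have Jji : J j (q i) by apply: (mono i.+1).
have qi0 : q i != 0 by apply/eqP => e; have [_ nJ _] := hq i; apply: nJ; rewrite e.
have qj0 : q j != 0 by apply/eqP => e; apply: nJj; rewrite e.
pose c := mleadc (q j) / mleadc (q i).
pose X : {mpoly K[n]} := 'X_[(mlead (q j) - mlead (q i))%MM].
pose s := (c *: X) * q i.
have Js i' : J i' (q i) -> J i' s by move=> h; apply: JM.
have JN i' y : J i' y -> J i' (- y) by rewrite -mulN1r; apply: JM.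
pose q' := q j - s.
have Jq' : J j.+1 q' by apply: JD => //; apply/JN/Js/Jinc.
have nJq' : ~ J j q'.
  by move=> h; apply: nJj; rewrite -[q j](subrK s); apply: JD => //; apply: Js.
have := minj _ Jq' nJq'.
have q'0 : q' != 0 by apply/eqP => e; apply: nJq'; rewrite e.
have li0 : mleadc (q i) != 0 by rewrite mleadc_eq0.
have lj0 : mleadc (q j) != 0 by rewrite mleadc_eq0.
have c0 : c != 0 by rewrite mulf_neq0 ?invr_eq0.
have X0 : X != 0 by rewrite -msupp_eq0 msuppX.
have ms : mlead s = mlead (q j).
  by rewrite /s -scalerAl mleadZ // mleadM // mleadXm submK.
have mc : mleadc s = mleadc (q j).
  rewrite /s -scalerAl mleadcZE mleadM // mleadcM mleadXm mcoeffX eqxx mul1r.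
  by rewrite divfK.
have : (mlead q' < mlead (q j))%O.
  rewrite lt_neqAle; apply/andP; split; last first.
    by apply: le_trans (mleadB_le _ _) _; rewrite ms joinxx.
  apply/eqP => e; move: q'0; rewrite -mleadc_eq0 e /q' mcoeffB -{2}ms mc subrr.
  by rewrite eqxx.
by rewrite ltNge => /negP.
Qed.

(** * Projective points, closed sets and curves *)

Section Projective.
Variables (K : fieldType) (N : nat).
Implicit Types (x y : pspace K N) (X Y : 'rV[K]_N.+1).

Lemma hcoords_neq0 x X : hcoords x X -> X != 0.
Proof.
case: x => L dL; rewrite /hcoords /= => LX.
by move: dL; rewrite LX dim_vline; case: (X != 0).
Qed.

Lemma hcoords_mem x X Y : hcoords x X -> Y \in pline x -> exists c, Y = c *: X.
Proof. by rewrite /hcoords => ->; move/vlineP. Qed.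

Lemma mem_hcoords x Y : Y \in pline x -> Y != 0 -> hcoords x Y.
Proof.
case: x => L dL /= LY Y0; rewrite /hcoords /=; apply/esym/eqP.
by rewrite eqEdim -memvE LY dim_vline Y0 (eqP dL).
Qed.

Lemma mem_pline x X : hcoords x X -> X \in pline x.
Proof. by rewrite /hcoords => ->; rewrite memv_line. Qed.

Lemma hcoords_vpick x : hcoords x (vpick (pline x)).
Proof.
apply: mem_hcoords (memv_pick _) _; case: x => L dL /=.
by rewrite vpick0; apply: contraTneq dL => ->; rewrite dimv0.
Qed.

Lemma hcoordsZ x X c : hcoords x X -> c != 0 -> hcoords x (c *: X).
Proof.
move=> hX c0; apply: mem_hcoords; first by rewrite memvZ // mem_pline.
by rewrite scaler_eq0 negb_or c0 (hcoords_neq0 hX).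
Qed.

Lemma hcoords_inj x y X : hcoords x X -> hcoords y X -> x = y.
Proof. by rewrite /hcoords => hx hy; apply: val_inj; rewrite /= hx hy. Qed.

Lemma hcoords_exists X : X != 0 -> exists x, hcoords x X.
Proof.
move=> X0; have dX : \dim <[X]>%VS == 1%N by rewrite dim_vline X0.
by exists (PPoint dX).
Qed.

Lemma rV_neq0 X : X != 0 -> exists i, X 0 i != 0.
Proof. by move=> /rV0Pn. Qed.

Lemma meval_homogZ (F : {mpoly K[N.+1]}) e c X :
  F \is e.-homog -> F.@[(c *: X) 0] = c ^+ e * F.@[X 0].
Proof.
move=> hF; rewrite !mevalE mulr_sumr; apply: eq_big_seq => m ms.
rewrite mulrCA; congr (_ * _); rewrite -(dhomog_mf hF ms) /= mdegE expr_sum.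
by rewrite -big_split /=; apply: eq_bigr => i _; rewrite mxE exprMn.
Qed.

Lemma vanishes_at_form (F : {mpoly K[N.+1]}) e x X :
  F \is e.-homog -> hcoords x X -> F.@[X 0] = 0 -> vanishes_at F x.
Proof.
move=> hF hX F0 Y /mem_pline/(hcoords_mem hX)[c ->].
by rewrite (meval_homogZ _ _ hF) F0 mulr0.
Qed.

Lemma eval_formsZ (G : N.+1.-tuple {mpoly K[N.+1]}) e c X :
  forms_of_degree e G -> eval_forms G (c *: X) = c ^+ e *: eval_forms G X.
Proof. by move=> hG; apply/rowP => i; rewrite !mxE (meval_homogZ _ _ (hG i)). Qed.

Lemma hyperplane_form i j (a b : K) :
  (a *: 'X_i - b *: 'X_j : {mpoly K[N.+1]}) \is 1.-homog.
Proof. by rewrite rpredB // rpredZ // dhomogX /= mdeg1. Qed.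

Lemma closed_setI_form (Z : set (pspace K N)) G :
  zariski_closed Z -> is_form G ->
  zariski_closed (Z `&` [set x | vanishes_at G x]).
Proof.
move=> [S Sf ->] Gf; exists (S `|` [set G]).
  by move=> F [/Sf //|->].
apply/seteqP; split => [x [hS hG] F [/hS //|->//]|x h].
by split => [F SF|]; apply: h; [left|right].
Qed.

Lemma closed_setI (Z1 Z2 : set (pspace K N)) :
  zariski_closed Z1 -> zariski_closed Z2 -> zariski_closed (Z1 `&` Z2).
Proof.
move=> [S1 f1 ->] [S2 f2 ->]; exists (S1 `|` S2); first by move=> F [/f1|/f2].
apply/seteqP; split => [x [h1 h2] F [/h1|/h2] //|x h].
by split => F SF; apply: h; [left|right].
Qed.

Lemma closed_form G : is_form G ->
  zariski_closed [set x : pspace K N | vanishes_at G x].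
Proof.
move=> Gf; exists [set G]; first by move=> F ->.
by apply/seteqP; split => [x h F -> //|x h]; apply: h.
Qed.

Lemma closed_set1 x : zariski_closed [set x].
Proof.
have hx := hcoords_vpick x; set X := vpick _ in hx.
pose S : set {mpoly K[N.+1]} :=
  [set F | exists i j, F = X 0 j *: 'X_i - X 0 i *: 'X_j].
exists S; first by move=> _ [i [j ->]]; exists 1%N; apply: hyperplane_form.
apply/seteqP; split => [_ -> _ [i [j ->]]|y h].
  apply: (vanishes_at_form (hyperplane_form _ _ _ _) hx).
  by rewrite mevalB !mevalZ !mevalXU mulrC subrr.
have hy := hcoords_vpick y; set Y := vpick _ in hy.
have rel i j : X 0 j * Y 0 i = X 0 i * Y 0 j.
  have /h/(_ _ hy) : S (X 0 j *: 'X_i - X 0 i *: 'X_j) by exists i, j.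
  by rewrite mevalB !mevalZ !mevalXU => /eqP; rewrite subr_eq0 => /eqP.
have [j Xj] := rV_neq0 (hcoords_neq0 hx).
have YE : Y = (Y 0 j / X 0 j) *: X.
  by apply/rowP => i; rewrite !mxE mulrAC [Y 0 j * _]mulrC -rel mulrAC mulfV ?mul1r.
apply: (hcoords_inj hy); rewrite YE; apply: hcoordsZ => //.
apply: contraNneq (hcoords_neq0 hy) => e.
by rewrite YE e scale0r.
Qed.

Lemma irreducible_set1 x : irreducible_closed [set x].
Proof.
split; [exact: closed_set1|by exists x|move=> A B _ _ AB].
by have [Ax|Bx] := AB x erefl; [left|right] => _ ->.
Qed.

Lemma closed_sub_ideal (Z1 Z2 : set (pspace K N)) :
  zariski_closed Z2 -> ideal_of Z2 `<=` ideal_of Z1 -> Z1 `<=` Z2.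
Proof.
move=> [S Sf ->] h x Z1x F SF; apply: (h F) => //= y; exact.
Qed.

(** A family without minimal element would contain a strictly decreasing
sequence, hence yield a strictly increasing sequence of ideals. *)
Lemma exists_minimal_closed (P : set (set (pspace K N))) :
  P `<=` @zariski_closed K N -> P !=set0 ->
  exists2 Z, P Z & forall Z', P Z' -> Z' `<=` Z -> Z' = Z.
Proof.
move=> Pc [Z0 PZ0]; apply: contrapT => nomin.
have ex (Z : {Z | P Z}) : exists Z' : {Z | P Z}, sval Z' `<` sval Z.
  case: Z => Z PZ; apply: contrapT => h; apply: nomin; exists Z => // Z' PZ' Z'Z.
  apply/seteqP; split => //; apply: contrapT => nZ; apply: h.
  by exists (exist _ Z' PZ').
have [s hs] := @choice _ _ _ ex.
pose Z i := sval (iter i s (exist _ Z0 PZ0)).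
have ZS i : Z i.+1 `<` Z i by exact: hs.
have [i hi] : exists i, ideal_of (Z i.+1) `<=` ideal_of (Z i).
  apply: (@ideal_chain_stationary K N.+1 (fun i => ideal_of (Z i))) => i.
  - move=> F G hF hG x Zx X hX.
    by rewrite mevalD (hF x Zx X hX) (hG x Zx X hX) addr0.
  - by move=> F G hF x Zx X hX; rewrite mevalM (hF x Zx X hX) mulr0.
  - by move=> x _ X _; rewrite meval0.
  - by move=> F hF x Zx; apply: hF; apply: (ZS i).1.
have Zc : zariski_closed (Z i.+1) by apply: Pc; rewrite /Z; case: (iter _ _ _).
by have [_ ] := ZS i; apply; apply: closed_sub_ideal Zc hi.
Qed.

Section Curve.
Variable C : set (pspace K N).
Hypothesis C_curve : irreducible_curve C.

Lemma ideal_of_prime F G : is_form F -> is_form G ->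
  ideal_of C (F * G) -> ideal_of C F \/ ideal_of C G.
Proof.
move=> Ff Gf FG; have [[_ _ irr] _] := C_curve.
have := irr _ _ (closed_form Ff) (closed_form Gf).
case=> [x Cx|h|h]; [|by left|by right].
have hx := hcoords_vpick x; have := FG x Cx _ hx.
rewrite mevalM => /eqP; rewrite mulf_eq0 => /orP[] /eqP e.
  by left; case: Ff => d hF; apply: vanishes_at_form hF hx e.
by right; case: Gf => d hG; apply: vanishes_at_form hG hx e.
Qed.

(** A minimal infinite closed subset of the zero locus is irreducible; if it were
proper in [C] it would lie strictly between a point and [C]. *)
Lemma infinite_dense_form G : is_form G ->
  infinite_set (C `&` [set x | vanishes_at G x]) -> ideal_of C G.
Proof.
move=> Gf infG; have [[Cc Cn Cirr] [_ nochain]] := C_curve.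
pose P Z := [/\ zariski_closed Z, infinite_set Z & Z `<=` C].
pose D := C `&` [set x | vanishes_at G x].
have PD : P D by split; [exact: closed_setI_form| |exact: subIsetl].
pose Q Z := P Z /\ Z `<=` D.
have [||W [[Wc Winf WC] WD] minW] := @exists_minimal_closed Q.
- by move=> Z [[]].
- by exists D; split.
have Wirr : irreducible_closed W.
  split => //.
    apply/set0P/eqP => W0; apply: Winf; rewrite W0; exact: finite_set0.
  have one A : zariski_closed A -> infinite_set (W `&` A) -> W `<=` A.
    move=> Ac iA; have <- : W `&` A = W; last exact: subIsetr.
    apply: minW; last exact: subIsetl.
    split; last by move=> x [/WD].
    by split => //; [exact: closed_setI|move=> x [/WC]].
  move=> A B Ac Bc WAB; have [fA|iA] := pselect (finite_set (W `&` A)); last first.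
    by left; apply: one.
  right; apply: one => // fB; apply: Winf.
  apply: sub_finite_set (_ : W `<=` (W `&` A) `|` (W `&` B)) _.
    by move=> x Wx; have [|] := WAB x Wx; [left|right].
  by rewrite finite_setU.
have [CW|nCW] := pselect (C `<=` W); first by move=> x /CW/WD[].
exfalso; apply: nochain.
have [x Wx] : W !=set0 by case: Wirr.
exists (fun i => if i is 0 then [set x] else if i is 1 then W else C); split.
  case=> [|[|[|i]]] // _; split => //.
    exact: irreducible_set1.
  by move=> _ ->; apply: WC.
case=> [|[|i]] // _.
  split => [_ -> //|h]; apply: Winf; exact: sub_finite_set h (finite_set1 x).
Qed.

End Curve.
End Projective.

(** * Extensions of degree 1 *)

(** For two indices [i0] and [i1] of a basis, [b i0] would be both [1 * b i0] and
[(b i0 / b i1) * b i1]. *)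
Lemma ext_degree_le1 (L : fieldType) (M S : set L) d :
  M `<=` S -> M 0 -> M 1 -> (forall a b, M a -> M b -> M (a / b)) ->
  ext_degree M S d -> (d <= 1)%N.
Proof.
move=> MS M0 M1 Mdiv [b [Mb hb]]; rewrite leqNgt; apply/negP => d1.
pose i0 := Ordinal (ltnW d1); pose i1 := Ordinal d1.
pose e i a : {ffun 'I_d -> L} := [ffun j => if j == i then a else 0].
have Se i a : S a -> forall j, S (e i a j).
  by move=> Sa j; rewrite ffunE; case: eqP => // _; apply: MS.
have sum_e i a : \sum_(j < d) e i a j * b j = a * b i.
  rewrite (bigD1 i) //= big1 ?addr0 ?ffunE ?eqxx // => j ji.
  by rewrite ffunE (negbTE ji) mul0r.
have uniq_e i j a a' : S a -> S a' -> M (a * b i) -> a * b i = a' * b j ->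
    e i a = e j a'.
  move=> Sa Sa' Mx eq; have [c [_ uc]] := hb _ Mx.
  rewrite -(uc (e i a)) ?(uc (e j a')) //; split; rewrite ?sum_e //; exact: Se.
have b1 : b i1 != 0.
  apply/eqP => b1; have := uniq_e i1 i1 1 0 (MS _ M1) (MS _ M0).
  rewrite b1 !mulr0 => /(_ M0 erefl)/ffunP/(_ i1)/eqP.
  by rewrite !ffunE eqxx oner_eq0.
have Mq := Mdiv _ _ (Mb i0) (Mb i1).
have := uniq_e i0 i1 1 (b i0 / b i1) (MS _ M1) (MS _ Mq).
rewrite mul1r divfK // => /(_ (Mb i0) erefl)/ffunP/(_ i0)/eqP.
by rewrite !ffunE eqxx oner_eq0.
Qed.

(** * Iterates with infinitely many fixed points *)

Section Iterates.
Variables (K : fieldType) (N : nat) (C : set (pspace K N)).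
Variables (F : N.+1.-tuple {mpoly K[N.+1]}) (phi : pspace K N -> pspace K N).
Hypotheses (C_curve : irreducible_curve C) (phiP : is_morphism C F phi).

Notation subst := (fun Q : {mpoly K[N.+1]} => Q \mPo F).

Lemma meval_iter_subst k (Q : {mpoly K[N.+1]}) (Y : 'rV[K]_N.+1) :
  (iter k subst Q).@[Y 0] = Q.@[(iter k (eval_forms F) Y) 0].
Proof.
elim: k Y => [//|k IH] Y; rewrite [in RHS]iterSr -IH /= comp_mpoly_meval.
by apply: meval_eq => i; rewrite mxE.
Qed.

Lemma comp_mpoly_homog a e (Q : {mpoly K[N.+1]}) :
  forms_of_degree a F -> Q \is e.-homog -> Q \mPo F \is (a * e).-homog.
Proof.
move=> Fa Qe; rewrite comp_mpolyEX big_seq; apply: rpred_sum => m ms.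
apply: rpredZ; rewrite -(dhomog_mf Qe ms) /= mdegE big_distrr /=.
pose deg_eq (d : nat) (P : {mpoly K[N.+1]}) : Prop := P \is d.-homog.
have : deg_eq (\sum_(i < N.+1) a * m i)%N (\prod_(i < N.+1) tnth F i ^+ m i).
  apply: (big_rec2 deg_eq) => [|i d P _ hP]; first exact: dhomog1.
  by apply: dhomogM => //; apply: dhomogMn.
by rewrite comp_mpolyX.
Qed.

Lemma iter_subst_form k Q : is_form Q -> is_form (iter k subst Q).
Proof.
have [a Fa] := morphism_forms phiP.
move=> Qf; elim: k => [//|k [e he]].
by exists (a * e)%N; apply: comp_mpoly_homog.
Qed.

Lemma iter_phi_stable k y : C y -> C (iter k phi y).
Proof. by move=> Cy; elim: k => //= k; apply: (morphism_stable phiP). Qed.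

(** At a base point of [F] the value of [F] is zero, so that [F] maps the line
of a point of [C] into the line of its image in all cases. *)
Lemma eval_forms_line z Z :
  C z -> Z \in pline z -> eval_forms F Z \in pline (phi z).
Proof.
move=> Cz Zz; have hz := hcoords_vpick z; set Z0 := vpick _ in hz.
have [c ->] := hcoords_mem hz Zz; have [a Fa] := morphism_forms phiP.
rewrite (eval_formsZ _ _ Fa) memvZ //.
have [G [_ FG] /(_ _ hz)[G0 Gz]] := morphism_eval phiP Cz.
have [j Gj] := rV_neq0 G0; rewrite mxE in Gj.
have -> : eval_forms F Z0 =
    ((tnth F j).@[Z0 0] / (tnth G j).@[Z0 0]) *: eval_forms G Z0.
  apply/rowP => i; rewrite !mxE; have := FG i j z Cz _ hz.
  rewrite mevalB !mevalM => /eqP; rewrite subr_eq0 => /eqP e.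
  by rewrite mulrAC -e mulfK.
by rewrite memvZ // mem_pline.
Qed.

Lemma iter_eval_forms_line k z Z : C z -> Z \in pline z ->
  iter k (eval_forms F) Z \in pline (iter k phi z).
Proof.
move=> Cz Zz; elim: k => //= k IH.
by apply: eval_forms_line => //; apply: iter_phi_stable.
Qed.

Section InfinitelyManyFixedPoints.
Variable n : nat.
Hypothesis n_gt0 : (0 < n)%N.
Let Fix := [set y | C y /\ iter n phi y = y].
Hypothesis Fix_infinite : infinite_set Fix.

(** If the forms of one more iterate vanished on [C], then [phi^k] would map
the fixed points of [phi^n], injectively and up to finitely many exceptions,
into the finite set of base points of [F]. *)
Lemma iter_subst_neq0 k : exists i, ~ ideal_of C (iter k subst 'X_i).
Proof.
elim: k => [|k [i hi]].
  have [[_ [y Cy] _] _] := C_curve; have hy := hcoords_vpick y.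
  have [i Yi] := rV_neq0 (hcoords_neq0 hy); exists i => h.
  by have := h y Cy _ hy; rewrite mevalXU => /eqP; rewrite (negbTE Yi).
apply: contrapT => /forallNP h0.
have [l Fl] := morphism_nontrivial phiP; have [a Fa] := morphism_forms phiP.
have Xf j : is_form ('X_j : {mpoly K[N.+1]}).
  by exists 1%N; rewrite dhomogX /= mdeg1.
pose A := C `&` [set y | vanishes_at (iter k subst 'X_i) y].
pose B := C `&` [set y | vanishes_at (tnth F l) y].
have finA : finite_set A.
  by apply: contrapT => /(infinite_dense_form C_curve (iter_subst_form k (Xf i))).
have finB : finite_set B.
  have Ff : is_form (tnth F l) by exists a.
  by apply: contrapT => /(infinite_dense_form C_curve Ff).
apply: Fix_infinite.
(* inverse of [phi^k] on the fixed points of [phi^n], as [k <= n * k] *)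
pose back := iter (n * k - k) phi.
apply: sub_finite_set (_ : Fix `<=` A `|` back @` B) _; last first.
  by rewrite finite_setU; split => //; apply: finite_image.
move=> y [Cy fy]; have [|nv] := pselect (vanishes_at (iter k subst 'X_i) y).
  by left.
right; exists (iter k phi y); last first.
  rewrite /back -iterD subnK ?leq_pmull // mulnC iterM.
  by elim: (k) => //= m ->.
split; first exact: iter_phi_stable.
have hy := hcoords_vpick y; set Y := vpick _ in hy.
have Zl := iter_eval_forms_line k Cy (mem_pline hy).
set Z := iter k _ Y in Zl.
have Z0 : Z != 0.
  apply/eqP => Z0; apply: nv; have [e he] := iter_subst_form k (Xf i).
  by apply: (vanishes_at_form he hy); rewrite meval_iter_subst -/Z Z0 mevalXU mxE.
apply: (vanishes_at_form (Fa l) (mem_hcoords Zl Z0)).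
have := h0 l; move=> /contrapT/(_ y Cy _ hy).
by rewrite meval_iter_subst mevalXU /= -/Z mxE.
Qed.

(** Proportionality is a condition given by forms, and it holds at the fixed
points of [phi^n]. *)
Lemma iter_proportional y Y : C y -> hcoords y Y ->
  exists c, iter n (eval_forms F) Y = c *: Y.
Proof.
move=> Cy hy; pose P i j : {mpoly K[N.+1]} :=
  iter n subst 'X_i * 'X_j - iter n subst 'X_j * 'X_i.
have Xh j : ('X_j : {mpoly K[N.+1]}) \is 1.-homog by rewrite dhomogX /= mdeg1.
have Pf i j : is_form (P i j).
  have [e he] : exists e, forall l, iter n subst 'X_l \is e.-homog.
    have [a Fa] := morphism_forms phiP; exists (iter n (muln a) 1%N) => l.
    by elim: (n) => [|m IH] //=; apply: comp_mpoly_homog.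
  by exists (e + 1)%N; rewrite rpredB // dhomogM.
have PI i j : ideal_of C (P i j).
  apply: (infinite_dense_form C_curve) => // fin; apply: Fix_infinite.
  apply: sub_finite_set fin => z [Cz fz]; split => //.
  have hz := hcoords_vpick z; have [e he] := Pf i j.
  apply: (vanishes_at_form he hz); rewrite mevalB !mevalM !meval_iter_subst.
  have := iter_eval_forms_line n Cz (mem_pline hz); rewrite fz.
  by move=> /(hcoords_mem hz)[c ->]; rewrite !mevalXU !mxE; ring.
have [j Yj] := rV_neq0 (hcoords_neq0 hy).
exists ((iter n (eval_forms F) Y) 0 j / Y 0 j); apply/rowP => i; rewrite mxE.
have := PI i j y Cy _ hy; rewrite mevalB !mevalM !meval_iter_subst !mevalXU.
by move=> /eqP; rewrite subr_eq0 => /eqP e; rewrite mulrAC -e mulfK.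
Qed.

Section FunctionField.
Variables (L : fieldType) (pi : {rmorphism {mpoly K[N.+1]} -> L}).
Hypothesis piP : is_coord_fraction_field C pi.

Lemma pi_eq P Q : (forall y Y, C y -> hcoords y Y -> P.@[Y 0] = Q.@[Y 0]) ->
  pi P = pi Q.
Proof.
move=> h; apply/eqP; rewrite -subr_eq0 -rmorphB; apply/eqP/piP.1 => y Cy Y hy.
by rewrite mevalB (h y Y) // subrr.
Qed.

(** As [phi^n] is the identity on [C], every rational function [h] is the
pullback of [h o phi^(n-1)]. *)
Lemma pullback_surjective : rational_functions pi `<=` pullback_functions F pi.
Proof.
move=> _ [e [G [H [Ge He H0 ->]]]].
have [a Fa] := morphism_forms phiP.
have nE Q : iter n.-1 subst Q \mPo F = iter n subst Q.
  by rewrite -[in RHS](prednK n_gt0).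
have deg m Q : Q \is e.-homog -> iter m subst Q \is (iter m (muln a) e).-homog.
  by move=> Qe; elim: m => //= m; apply: comp_mpoly_homog.
have Hn0 : pi (iter n subst H) != 0.
  apply/eqP => Hn; have [i] := iter_subst_neq0 n; apply.
  apply/piP.1/eqP; have : pi (iter n subst 'X_i) ^+ e * pi H = 0.
    rewrite -rmorphXn -rmorphM; have := mulr0 (pi 'X_i ^+ e); rewrite -{1}Hn.
    rewrite -rmorphXn -rmorphM => <-; apply: pi_eq => y Y Cy hy.
    rewrite !mevalM !rmorphXn /= !meval_iter_subst.
    have [c ->] := iter_proportional Cy hy.
    by rewrite (meval_homogZ _ _ He) !mevalXU mxE exprMn; ring.
  move/eqP; rewrite mulf_eq0 (negbTE H0) orbF expf_eq0.
  by case/andP.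
exists (iter n.-1 (muln a) e), (iter n.-1 subst G), (iter n.-1 subst H).
rewrite !nE; split; rewrite ?deg //.
  apply: contra Hn0 => /eqP/piP.1 h; apply/eqP/piP.1 => y Cy Y hy.
  rewrite -nE comp_mpoly_meval.
  have -> : (iter n.-1 subst H).@[fun i => (tnth F i).@[Y 0]] =
      (iter n.-1 subst H).@[(eval_forms F Y) 0].
    by apply: meval_eq => i; rewrite mxE.
  have := eval_forms_line Cy (mem_pline hy).
  have hz := hcoords_vpick (phi y) => /(hcoords_mem hz)[c ->].
  rewrite (meval_homogZ _ _ (deg _ _ He)).
  by rewrite (h _ (morphism_stable phiP Cy) _ hz) mulr0.
apply/eqP; rewrite eqr_div // -!rmorphM; apply/eqP/pi_eq => y Y Cy hy.
rewrite !mevalM !meval_iter_subst; have [c ->] := iter_proportional Cy hy.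
by rewrite !(meval_homogZ _ _ Ge, meval_homogZ _ _ He); ring.
Qed.

End FunctionField.

Lemma morphism_degree_le1 d : morphism_degree C F d -> (d <= 1)%N.
Proof.
move=> [L [pi [piP deg]]]; apply: (ext_degree_le1 _ _ _ _ deg).
- exact: pullback_surjective.
- exists 0%N, 0, 1; split; rewrite ?dhomog0 ?dhomog1 ?rmorph1 ?oner_eq0 //.
  by rewrite rmorph0 mul0r.
- by exists 0%N, 1, 1; split; rewrite ?dhomog1 ?rmorph1 ?oner_eq0 ?divr1.
move=> _ _ [e [G [H [Ge He H0 ->]]]] [e' [G' [H' [Ge' He' H0' ->]]]].
have [G'0|G'0] := eqVneq (pi G') 0.
  exists 0%N, 0, 1; split; rewrite ?dhomog0 ?dhomog1 ?rmorph1 ?oner_eq0 //.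
  by rewrite G'0 rmorph0 !mul0r invr0 mulr0.
exists (e + e')%N, (G * H'), (H * G').
by split; rewrite ?dhomogM // ?rmorphM ?mulf_neq0 // invf_div mulf_div.
Qed.

End InfinitelyManyFixedPoints.
End Iterates.

(** * Integral polynomial maps and good reduction *)

(** Roots of [b] of high order have absolute value close to 1. *)
Lemma exists_abs_between (R : realType) (K : closedFieldType) (v : K -> R)
    (b : K) (s : R) :
  nonarchimedean v -> b != 0 -> v b < 1 -> s < 1 ->
  exists2 c, c != 0 & s <= v c < 1.
Proof.
move=> vP b0 b1 s1; pose s' := Num.max s 0.
have s'0 : 0 <= s' by rewrite le_max lexx orbT.
have s'1 : s' < 1 by rewrite gt_max s1 ltr01.
have [n hn] := exprn_small s'0 s'1 (abs_gt0 vP b0).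
have n0 : (0 < n)%N.
  by case: n hn => //; rewrite expr0 => /lt_trans/(_ b1); rewrite ltxx.
have [c /rootP hc] : exists c, root ('X^n - b%:P) c.
  by apply/closed_rootP; rewrite size_XnsubC // eqSS -lt0n.
have cE : v c ^+ n = v b.
  move: hc; rewrite !hornerE => /eqP; rewrite subr_eq0 => /eqP <-.
  by rewrite absX.
exists c.
  apply: contra_neq b0 => e; apply/(abs_eq0 vP).
  by rewrite -cE e abs0 // expr0n eqn0Ngt n0.
apply/andP; split.
  rewrite (le_trans (_ : s <= s')) ?le_max ?lexx //.
  rewrite leNgt; apply/negP => h; move: hn; rewrite -cE ltNge => /negP; apply.
  by rewrite ler_pXn2r ?nnegrE ?(abs_ge0 vP) // ltW.
rewrite ltNge; apply/negP => h; move: b1; rewrite -cE ltNge => /negP; apply.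
exact: exprn_ege1.
Qed.

Lemma finite_family_lt1 (R : realType) (I : finType) (F : I -> R) :
  (forall i, F i < 1) -> exists2 s, s < 1 & forall i, F i <= s.
Proof.
move=> h; exists (\big[Num.max/0]_i F i); last by move=> i; exact: le_bigmax.
by apply/bigmax_ltP.
Qed.

Section IntegralMaps.
Variables (R : realType) (K : fieldType) (v : K -> R) (N : nat).
Hypothesis vP : nonarchimedean v.

Definition int_row (X : 'rV[K]_N.+1) := forall i, v (X 0 i) <= 1.
Definition int_tuple (G : N.+1.-tuple {mpoly K[N.+1]}) :=
  forall i, tnth G i \is a mpolyOver N.+1 (Oint v).
Definition poly_map (s : seq (N.+1.-tuple {mpoly K[N.+1]})) X :=
  foldl (fun X G => eval_forms G X) X s.

Lemma integral_meval_ind (T : Type) (P : (T -> K) -> Prop) :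
  (forall c, v c <= 1 -> P (fun=> c)) ->
  (forall u1 u2, P u1 -> P u2 -> P (fun y => u1 y + u2 y)) ->
  (forall u1 u2, P u1 -> P u2 -> P (fun y => u1 y * u2 y)) ->
  forall (F : {mpoly K[N.+1]}) (Y : T -> 'rV[K]_N.+1),
  F \is a mpolyOver N.+1 (Oint v) -> (forall i, P (fun y => Y y 0 i)) ->
  P (fun y => F.@[(Y y) 0]).
Proof.
move=> Pc PD PM F Y FO PY.
have -> : (fun y => F.@[(Y y) 0]) =
    (fun y => \sum_(m <- msupp F) F@_m * \prod_(i <- enum 'I_N.+1) (Y y 0 i) ^+ m i).
  by apply/funext => y; rewrite mevalE; apply: eq_bigr => m _; rewrite big_enum.
elim: (msupp F) => [|m s IH].
  under eq_fun do rewrite big_nil.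
  by apply: (Pc); rewrite abs0.
under eq_fun do rewrite big_cons.
apply: (PD) => //; apply: (PM); first by apply: (Pc); apply: mpolyOver_coef.
elim: (enum _) => [|i r IHr].
  under eq_fun do rewrite big_nil.
  by apply: (Pc); rewrite abs1.
under eq_fun do rewrite big_cons.
apply: (PM) => //; elim: (m i) => [|e IHe].
  under eq_fun do rewrite expr0.
  by apply: (Pc); rewrite abs1.
under eq_fun do rewrite exprS.
exact: PM.
Qed.

Lemma integral_poly_map_ind (T : Type) (P : (T -> K) -> Prop) :
  (forall c, v c <= 1 -> P (fun=> c)) ->
  (forall u1 u2, P u1 -> P u2 -> P (fun y => u1 y + u2 y)) ->
  (forall u1 u2, P u1 -> P u2 -> P (fun y => u1 y * u2 y)) ->
  forall s (Y : T -> 'rV[K]_N.+1), {in s, forall G, int_tuple G} ->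
  (forall i, P (fun y => Y y 0 i)) -> forall i, P (fun y => poly_map s (Y y) 0 i).
Proof.
move=> Pc PD PM; elim=> [|G s IH] Y sO PY i //=.
apply: (IH (fun y => eval_forms G (Y y))).
  by move=> G' sG'; apply: sO; rewrite inE sG' orbT.
move=> j; under eq_fun do rewrite mxE.
by apply: integral_meval_ind => //; apply: sO; rewrite inE eqxx.
Qed.

(** The pairs of values at [X] and [Y] that are integral and at distance at most
[r] form an algebra over the valuation ring. *)
Lemma poly_map_lipschitz s X Y r : 0 <= r -> {in s, forall G, int_tuple G} ->
  int_row X -> int_row Y -> (forall i, v (X 0 i - Y 0 i) <= r) ->
  int_row (poly_map s X) /\
  forall i, v (poly_map s X 0 i - poly_map s Y 0 i) <= r.
Proof.
move=> r0 sO hX hY XY.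
pose P (u : bool -> K) := [/\ v (u true) <= 1, v (u false) <= 1 &
                              v (u true - u false) <= r].
have h i : P (fun b => poly_map s (if b then X else Y) 0 i).
  apply: (integral_poly_map_ind (P := P)) => //.
  - by move=> c c1; split; rewrite // subrr abs0.
  - move=> u1 u2 [h1 h2 h3] [k1 k2 k3]; split=> /=; try exact: absD_le.
    by rewrite opprD addrACA; apply: absD_le.
  - move=> u1 u2 [h1 h2 h3] [k1 k2 k3]; split=> /=; try exact: absM_le1.
    have -> : u1 true * u2 true - u1 false * u2 false =
      u1 true * (u2 true - u2 false) + (u1 true - u1 false) * u2 false by ring.
    apply: absD_le => //; rewrite (absM vP).
      by rewrite (le_trans _ k3) // ler_piMl ?(abs_ge0 vP).
    by rewrite (le_trans _ h3) // ler_piMr ?(abs_ge0 vP).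
by split=> i; have [] := h i.
Qed.

End IntegralMaps.

Section GoodReduction.
Variables (R : realType) (K k : fieldType) (v : K -> R) (red : K -> k).
Hypotheses (vP : nonarchimedean v) (redP : is_reduction v red).
Variables (N : nat) (C : set (pspace K N)).
Variables (F : N.+1.-tuple {mpoly K[N.+1]}) (phi : pspace K N -> pspace K N).
Hypotheses (C_curve : irreducible_curve C) (phiP : is_morphism C F phi).
Hypothesis phi_good : morphism_good_reduction v red C F.

(** Two representations of [phi] are proportional also at the base points of
[F], since the ideal of [C] is prime. *)
Lemma represents_hcoords G y Y : represents C F G -> C y -> hcoords y Y ->
  eval_forms G Y != 0 -> hcoords (phi y) (eval_forms G Y).
Proof.
move=> [[e Ge] FG] Cy hy G0.
have [l Fl] := morphism_nontrivial phiP; have [a Fa] := morphism_forms phiP.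
have [G' [[e' Ge'] FG'] /(_ _ hy)[G'0 G'y]] := morphism_eval phiP Cy.
pose D i j := tnth G i * tnth G' j - tnth G j * tnth G' i.
have DI i j : ideal_of C (D i j).
  have Df : is_form (D i j) by exists (e + e')%N; rewrite rpredB ?dhomogM.
  have Ff : is_form (tnth F l) by exists a.
  case: (ideal_of_prime C_curve Ff Df) => // z Cz Z hz.
  have E (i1 i2 : 'I_N.+1) G1 :
      ideal_of C (tnth F i1 * tnth G1 i2 - tnth F i2 * tnth G1 i1) ->
      (tnth F i1).@[Z 0] * (tnth G1 i2).@[Z 0]
      = (tnth F i2).@[Z 0] * (tnth G1 i1).@[Z 0].
    move=> /(_ z Cz Z hz); rewrite mevalB !mevalM => /eqP.
    by rewrite subr_eq0 => /eqP.
  rewrite mevalM mevalB !mevalM mulrBr !mulrA (E _ _ _ (FG l i)) (E _ _ _ (FG l j)).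
  have := E _ _ _ (FG' i j).
  set x1 := (tnth F i).@[_]; set x2 := (tnth F j).@[_] => E1.
  rewrite -mulrA mulrCA E1; ring.
have [j Gj] := rV_neq0 G'0; rewrite mxE in Gj.
apply: mem_hcoords => //.
have -> : eval_forms G Y =
    ((tnth G j).@[Y 0] / (tnth G' j).@[Y 0]) *: eval_forms G' Y.
  apply/rowP => i; rewrite !mxE; have := DI i j y Cy _ hy.
  rewrite mevalB !mevalM => /eqP; rewrite subr_eq0 => /eqP e1.
  by rewrite mulrAC -e1 mulfK.
by rewrite memvZ // mem_pline.
Qed.

(** The reduced ideal contains inhomogeneous polynomials, so that all the
multiples of the reduced coordinates have to be considered; they lift to
multiples of [Z]. *)
Lemma reduction_point z Z : C z -> hcoords z Z -> int_row v Z ->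
  (exists j, v (Z 0 j) = 1) ->
  exists2 zb, reduced_curve v red C zb & hcoords zb (map_mx red Z).
Proof.
move=> Cz hz Zint [j Zj].
have rj : red (Z 0 j) != 0 by rewrite (red_neq0 redP) ?Zj.
have [|zb hzb] := @hcoords_exists k N (map_mx red Z).
  by apply: contraNneq rj => /rowP/(_ j); rewrite !mxE => ->.
exists zb => // G [GI GO] X hX.
have [sb XE] := hcoords_mem hzb (mem_pline hX).
have [s s1 sbE] := red_surj redP sb; rewrite inE in s1.
have -> : (map_mpoly red G).@[X 0] =
    (map_mpoly red G).@[fun i => red ((s *: Z) 0 i)].
  by apply: meval_eq => i; rewrite XE !mxE (redM redP) ?inE // sbE.
rewrite (meval_map_red vP redP) //; last first.
  by move=> i; rewrite mxE absM_le1.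
rewrite (_ : G.@[_] = 0) ?(red0 vP redP) //.
apply: (GI z Cz); apply: hcoordsZ => //; apply: contraNneq (hcoords_neq0 hX) => s0.
by rewrite XE -sbE s0 (red0 vP redP) scale0r.
Qed.

(** The forms given by good reduction at the reduction of [z] have a unit value at
[Z], hence at all points of the residue disc. *)
Lemma good_step z Z : C z -> hcoords z Z -> int_row v Z ->
  (exists j, v (Z 0 j) = 1) ->
  exists2 G, int_tuple v G & forall y Y r, C y -> hcoords y Y -> int_row v Y ->
    0 <= r -> r < 1 -> (forall i, v (Y 0 i - Z 0 i) <= r) ->
    hcoords (phi y) (eval_forms G Y) /\ exists j, v (eval_forms G Y 0 j) = 1.
Proof.
move=> Cz hz Zint Z1; have [zb Czb hzb] := reduction_point Cz hz Zint Z1.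
have [G [FG GO /(_ _ hzb)/rV_neq0[j Gj]]] := phi_good Czb.
exists G => // y Y r Cy hy Yint r0 r1 YZ.
have sO : {in [:: G], forall G', int_tuple v G'}.
  by move=> G'; rewrite inE => /eqP ->.
have [Gint GYZ] := poly_map_lipschitz vP r0 sO Yint Zint YZ.
have GZint : int_row v (eval_forms G Z).
  have ZZ i : v (Z 0 i - Z 0 i) <= r by rewrite subrr abs0.
  by have [] := poly_map_lipschitz vP r0 sO Zint Zint ZZ.
have GZj : v (eval_forms G Z 0 j) = 1.
  apply/eqP; rewrite -(red_neq0 redP) // mxE -(meval_map_red vP redP) //.
  move: Gj; rewrite mxE tnth_map; congr (_ != _).
  by apply: meval_eq => i; rewrite mxE.
have GYj : v (eval_forms G Y 0 j) = 1.
  by rewrite -GZj; apply: abs_near => //; rewrite GZj (le_lt_trans (GYZ j)).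
split; last by exists j.
apply: represents_hcoords => //; apply/eqP => /rowP/(_ j); rewrite [RHS]mxE => e.
by move: GYj; rewrite e abs0 // => /esym/eqP; rewrite oner_eq0.
Qed.

Lemma good_chain m z Z r : 0 <= r -> r < 1 ->
  C z -> hcoords z Z -> int_row v Z -> (exists j, v (Z 0 j) = 1) ->
  exists2 s, {in s, forall G, int_tuple v G} &
  forall y Y, C y -> hcoords y Y -> int_row v Y ->
    (forall i, v (Y 0 i - Z 0 i) <= r) -> (exists j, v (Y 0 j) = 1) ->
    hcoords (iter m phi y) (poly_map s Y) /\ exists j, v (poly_map s Y 0 j) = 1.
Proof.
move=> r0 r1 Cz hz Zint Z1; elim: m => [|m [s sO hs]].
  by exists [::].
have ZZ i : v (Z 0 i - Z 0 i) <= r by rewrite subrr abs0.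
have [hz' Z1'] := hs z Z Cz hz Zint ZZ Z1.
have [Z'int _] := poly_map_lipschitz vP r0 sO Zint Zint ZZ.
have Cz' := iter_phi_stable phiP m Cz.
have [G GO hG] := good_step Cz' hz' Z'int Z1'.
exists (rcons s G).
  by move=> G'; rewrite mem_rcons inE => /predU1P[->|/sO].
move=> y Y Cy hy Yint YZ Y1; rewrite /poly_map foldl_rcons.
have [hy' _] := hs y Y Cy hy Yint YZ Y1.
have [Y'int Y'Z'] := poly_map_lipschitz vP r0 sO Yint Zint YZ.
by have := hG _ _ _ (iter_phi_stable phiP m Cy) hy' Y'int r0 r1 Y'Z'.
Qed.

End GoodReduction.

(** * The return map of a residue disc *)

Section FirstOrder.
Variables (R : realType) (K : fieldType) (v : K -> R).
Hypothesis vP : nonarchimedean v.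
Variables (T : Type) (N : nat) (f g : T -> T) (w : 'I_N.+1 -> T -> K) (c : K).
Hypotheses (w_int : forall i y, v (w i y) <= 1) (c1 : v c < 1).
Notation integral_fun := (integral_fun v f g w).

(** A first order Taylor expansion in the unscaled coordinates [c * w]: the
quadratic terms are divisible by [c ^ 2], so that after a division by [c] only
the linear part is left modulo [c]. *)
Definition first_order (u : T -> K) := exists q b k,
  [/\ v q <= 1, forall j, v (b j) <= 1, integral_fun k & forall y,
      u y = q + c * (\sum_(j < N.+1) b j * w j y) + c ^+ 2 * k y].

Let integral_c : integral_fun (fun=> c).
Proof. exact: integral_cst (ltW c1). Qed.

Lemma integral_linear (b : 'I_N.+1 -> K) : (forall j, v (b j) <= 1) ->
  integral_fun (fun y => \sum_(j < N.+1) b j * w j y).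
Proof.
move=> hb; apply: integral_sum => // j.
by apply: integralM; [exact: integral_cst|exact: integral_coord].
Qed.

Lemma integral0 : integral_fun (fun=> 0).
Proof. by apply: integral_cst; rewrite abs0. Qed.

Lemma first_order_cst a : v a <= 1 -> first_order (fun=> a).
Proof.
move=> a1; exists a, (fun=> 0), (fun=> 0); split => //.
- by move=> j; rewrite abs0.
- exact: integral0.
- by move=> y; rewrite big1 ?mulr0 ?addr0 // => j _; rewrite mul0r.
Qed.

Lemma first_order_coord i : first_order (fun y => c * w i y).
Proof.
exists 0, (fun j => (j == i)%:R), (fun=> 0); split => //.
- by rewrite abs0.
- by move=> j; rewrite abs_nat_le1.
- exact: integral0.
- move=> y; rewrite (bigD1 i) //= eqxx mul1r big1 ?mulr0 ?addr0 ?add0r // => j.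
  by move=> /negbTE ->; rewrite mul0r.
Qed.

Lemma first_orderD u1 u2 :
  first_order u1 -> first_order u2 -> first_order (fun y => u1 y + u2 y).
Proof.
move=> [q1 [b1 [k1 [hq1 hb1 hk1 e1]]]] [q2 [b2 [k2 [hq2 hb2 hk2 e2]]]].
exists (q1 + q2), (fun j => b1 j + b2 j), (fun y => k1 y + k2 y); split.
- exact: absD_le.
- by move=> j; exact: absD_le.
- exact: integralD.
- move=> y; rewrite e1 e2.
  under [in RHS]eq_bigr do rewrite mulrDl.
  by rewrite big_split /=; ring.
Qed.

Lemma first_orderM u1 u2 :
  first_order u1 -> first_order u2 -> first_order (fun y => u1 y * u2 y).
Proof.
move=> [q1 [b1 [k1 [hq1 hb1 hk1 e1]]]] [q2 [b2 [k2 [hq2 hb2 hk2 e2]]]].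
pose l1 y := \sum_(j < N.+1) b1 j * w j y.
pose l2 y := \sum_(j < N.+1) b2 j * w j y.
have hl1 : integral_fun l1 by exact: integral_linear.
have hl2 : integral_fun l2 by exact: integral_linear.
have hcst a : v a <= 1 -> integral_fun (fun=> a) by exact: integral_cst.
have i1 := hcst _ hq1; have i2 := hcst _ hq2.
exists (q1 * q2), (fun j => q1 * b2 j + q2 * b1 j),
  (fun y => q1 * k2 y + (q2 * k1 y + (l1 y + c * k1 y) * (l2 y + c * k2 y))).
split.
- exact: absM_le1.
- by move=> j; apply: absD_le => //; exact: absM_le1.
- apply: integralD; first exact: integralM.
  apply: integralD; first exact: integralM.
  by apply: integralM; apply: integralD => //; apply: integralM.
- move=> y; rewrite e1 e2 -/(l1 y) -/(l2 y).
  have -> : \sum_(j < N.+1) (q1 * b2 j + q2 * b1 j) * w j y = q1 * l2 y + q2 * l1 y.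
    rewrite !mulr_sumr -big_split /=; apply: eq_bigr => j _; ring.
  ring.
Qed.

Lemma first_orderV u : first_order u -> (forall y, v (u y) = 1) ->
  first_order (fun y => (u y)^-1).
Proof.
move=> [q [b [k [hq hb hk e]]]] u1.
pose l y := \sum_(j < N.+1) b j * w j y.
have hl : integral_fun l by exact: integral_linear.
pose s y := l y + c * k y.
have hs : integral_fun s by apply: integralD => //; exact: integralM.
have uE y : u y = q + c * s y by rewrite e /s -/(l y); ring.
(* [q] is a unit because [u] has a unit value; on an empty [T] any expansion
   will do *)
have [y0|noT] := pselect (exists y : T, True); last first.
  exists 0, (fun=> 0), (fun=> 0); split.
  - by rewrite abs0.
  - by move=> j; rewrite abs0.
  - exact: integral0.
  - by move=> y; case: noT; exists y.
have qu : v q = 1.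
  case: y0 => y _; rewrite -(u1 y); apply: abs_near => //.
  rewrite u1 uE opprD addrA subrr add0r absN //.
  rewrite mulrC absM_lt1 // (integral_le1 _ _ hs) //.
have nz z : v z = 1 -> z != 0.
  by move=> hz; apply: contra_eq_neq hz => ->; rewrite abs0 // eq_sym oner_eq0.
have q0 := nz _ qu; have u0 y := nz _ (u1 y).
have qV : v q^-1 = 1 by rewrite absV // qu invr1.
have iq : integral_fun (fun=> q^-1) by apply: integral_cst; rewrite qV.
have iu : integral_fun (fun y => (u y)^-1).
  apply: integralV => //.
  apply: (@integral_ext _ _ _ _ _ _ _ _ (fun y => q + c * s y)).
    by move=> y; rewrite uE.
  by apply: integralD; [exact: integral_cst|exact: integralM].
exists q^-1, (fun j => - (q^-1 * q^-1 * b j)),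
  (fun y => - (q^-1 * q^-1 * k y) + q^-1 * q^-1 * (s y * (s y * (u y)^-1))).
split; first by rewrite qV.
- by move=> j; rewrite absN // !absM_le1 ?qV.
- apply: integralD.
    by apply: integralN => //; do ?[exact: integralM | apply: integralM].
  by apply: integralM; [exact: integralM|apply: integralM => //; exact: integralM].
- move=> y.
  have -> : \sum_(j < N.+1) - (q^-1 * q^-1 * b j) * w j y = - (q^-1 * q^-1 * l y).
    by rewrite mulr_sumr -sumrN; apply: eq_bigr => j _; ring.
  have -> : l y = s y - c * k y by rewrite /s addrK.
  have := u0 y; rewrite uE => u0'.
  by field; rewrite q0 andbT.
Qed.

End FirstOrder.

Section ResidueDisc.
Variables (R : realType) (p : nat) (Qp : fieldType) (K k : closedFieldType).
Variables (emb : {rmorphism Qp -> K}) (v : K -> R) (red : K -> k).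
Hypotheses (p_prime : prime p) (padic : is_padic_closure p emb v).
Hypothesis redP : is_reduction v red.
Variables (N : nat) (C : set (pspace K N)).
Variables (F : N.+1.-tuple {mpoly K[N.+1]}) (phi : pspace K N -> pspace K N).
Hypotheses (C_curve : irreducible_curve C) (phiP : is_morphism C F phi).
Hypothesis phi_good : morphism_good_reduction v red C F.

Let vP : nonarchimedean v := padic_nonarchimedean padic.

Section Disc.
Variables (a : 'I_N.+1) (y0 : pspace K N) (c : K) (m : nat).
Hypotheses (Cy0 : C y0) (c0 : c != 0) (c1 : v c < 1).
Hypotheses (m_gt0 : (0 < m)%N) (y0_per : iter m phi y0 = y0).

Definition centered_at (Y0 : 'rV[K]_N.+1) y (Y : 'rV[K]_N.+1) :=
  [/\ hcoords y Y, Y 0 a = 1 & forall i, v (Y 0 i - Y0 0 i) <= v c].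

Variable Y0 : 'rV[K]_N.+1.
Hypotheses (hY0 : hcoords y0 Y0) (Y0a : Y0 0 a = 1) (Y0_int : int_row v Y0).

Definition periodic_in_disc y :=
  [/\ C y, periodic phi y & exists Y, centered_at Y0 y Y].

Let v_neq0 x : v x = 1 -> x != 0.
Proof.
by move=> h; apply: contra_eq_neq h => ->; rewrite abs0 // eq_sym oner_eq0.
Qed.

Lemma centered_int y Y : centered_at Y0 y Y -> int_row v Y.
Proof.
move=> [_ _ h] i; rewrite -[Y 0 i](subrK (Y0 0 i)) absD_le //.
by rewrite (le_trans (h i)) // ltW.
Qed.

Lemma centered_uniq y Y Y' : centered_at Y0 y Y -> centered_at Y0 y Y' -> Y = Y'.
Proof.
move=> [hY Ya _] [hY' Ya' _]; have [b e] := hcoords_mem hY (mem_pline hY').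
by move: Ya'; rewrite e mxE Ya mulr1 => ->; rewrite scale1r.
Qed.

(** At [y0] the polynomial map returns a multiple of [Y0], whose [a]-th
coordinate is a unit; it remains one on the disc, so that [phi^m] maps the disc
to itself. *)
Lemma disc_chain : exists2 s, {in s, forall G, int_tuple v G} &
  forall y Y, C y -> centered_at Y0 y Y ->
    v (poly_map s Y 0 a) = 1 /\
    centered_at Y0 (iter m phi y) ((poly_map s Y 0 a)^-1 *: poly_map s Y).
Proof.
have Z1 (Y : 'rV[K]_N.+1) : Y 0 a = 1 -> exists j, v (Y 0 j) = 1.
  by move=> e; exists a; rewrite e abs1.
have [s sO hs] := good_chain vP redP C_curve phiP phi_good m (abs_ge0 vP c) c1
  Cy0 hY0 Y0_int (Z1 _ Y0a).
exists s => // y Y Cy cY; have [hY Ya YY0] := cY; have Yint := centered_int cY.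
have [hy _] := hs y Y Cy hY Yint YY0 (Z1 _ Ya).
have YY00 i : v (Y0 0 i - Y0 0 i) <= v c by rewrite subrr abs0 // (abs_ge0 vP).
have [h0 [j0 hj0]] := hs y0 Y0 Cy0 hY0 Y0_int YY00 (Z1 _ Y0a).
have [Z0int _] := poly_map_lipschitz vP (abs_ge0 vP c) sO Y0_int Y0_int YY00.
have [Zint ZZ0] := poly_map_lipschitz vP (abs_ge0 vP c) sO Yint Y0_int YY0.
rewrite y0_per in h0; have [b bE] := hcoords_mem hY0 (mem_pline h0).
set Z := poly_map s Y in hy Zint ZZ0 *.
set Z0 := poly_map s Y0 in h0 hj0 Z0int ZZ0 bE.
have Z0a : Z0 0 a = b by rewrite bE mxE Y0a mulr1.
have b1 : v b = 1.
  apply/le_anti; rewrite -{1}Z0a Z0int /= -hj0 bE mxE (absM vP).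
  by rewrite ler_piMr ?(abs_ge0 vP).
have Za1 : v (Z 0 a) = 1.
  rewrite -b1 -Z0a; apply: abs_near => //.
  by rewrite (le_lt_trans (ZZ0 a)) // Z0a b1.
have Za0 := v_neq0 Za1; have b0 := v_neq0 b1.
split => //; split; first by apply: hcoordsZ => //; rewrite invr_eq0.
  by rewrite mxE mulVf.
move=> i; rewrite mxE.
have -> : (Z 0 a)^-1 * Z 0 i - Y0 0 i =
    (Z 0 a)^-1 * ((Z 0 i - Z0 0 i) - Y0 0 i * (Z 0 a - Z0 0 a)).
  by rewrite Z0a bE mxE; field.
rewrite (absM vP) absV // Za1 invr1 mul1r absB_le // (absM vP).
by rewrite (le_trans _ (ZZ0 a)) // ler_piMl ?(abs_ge0 vP).
Qed.

(** Periodic points have periodic preimages, so [phi^m] induces a bijection of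
the periodic points of the disc; as [phi^m] fixes [y0], its first order expansion
is linear modulo [c] in the coordinates centered at [y0] and divided by [c]. *)
Lemma disc_common_period : exists2 n, (0 < n)%N &
  forall y, periodic_in_disc y -> iter n phi y = y.
Proof.
have [s sO hs] := disc_chain.
pose T := {y | periodic_in_disc y}.
have Cpt (y : T) : C (sval y) by case: y => y [].
have [lift liftP] : {lift : T -> 'rV[K]_N.+1 &
    forall y, centered_at Y0 (sval y) (lift y)}.
  apply: (@choice T 'rV[K]_N.+1 (fun y Y => centered_at Y0 (sval y) Y)).
  by move=> [y hy]; have [_ _ h] := hy.
have T_inj (y z : T) : sval y = sval z -> y = z.
  by case: y z => [y hy] [z hz] /= e; subst z; congr exist; exact: Prop_irrelevance.
have iter_add q r y : iter q phi (iter r phi y) = iter r phi (iter q phi y).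
  by rewrite -!iterD addnC.
have [f fE] : {f : T -> T & forall y, sval (f y) = iter m phi (sval y)}.
  apply: (@choice T T (fun y z => sval z = iter m phi (sval y))) => -[y hy].
  suff hz : periodic_in_disc (iter m phi y) by exists (exist _ _ hz).
  have [Cy [q q0 qy] [Y cY]] := hy; split; first exact: (iter_phi_stable phiP).
    by exists q => //; rewrite iter_add qy.
  by have [_ h] := hs y Y Cy cY; exists ((poly_map s Y 0 a)^-1 *: poly_map s Y).
have fiterE q y : sval (iter q f y) = iter (q * m) phi (sval y).
  by elim: q => [//|q IH]; rewrite iterS fE IH -iterD.
have f_per (y : T) : exists2 q, (0 < q)%N & iter q f y = y.
  case: y => y hy; have [_ [q q0 qy] _] := hy; exists q => //.
  apply: T_inj; rewrite fiterE /= mulnC iterM.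
  by elim: (m) => //= l ->.
have iter_mul q r (y : T) : iter q f y = y -> iter (r * q) f y = y.
  by move=> qy; rewrite iterM; elim: r => //= r ->.
have f_inj : injective f.
  move=> y z e; have [q q0 qy] := f_per y; have [r r0 rz] := f_per z.
  have qr0 : (0 < r * q)%N by rewrite muln_gt0 r0.
  rewrite -(iter_mul _ r _ qy) -[in RHS](iter_mul _ q _ rz) [in RHS]mulnC.
  by rewrite -(prednK qr0) !iterSr e.
have [g gK] : {g : T -> T & cancel g f}.
  apply: (@choice T T (fun y z => f z = y)) => y; have [q q0 qy] := f_per y.
  by exists (iter q.-1 f y); rewrite -iterS prednK.
have fK : cancel f g by move=> y; apply: f_inj; rewrite gK.
have o_disc : periodic_in_disc y0.
  split => //; [by exists m|exists Y0; split => // i].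
  by rewrite subrr abs0 // (abs_ge0 vP).
pose o : T := exist _ y0 o_disc.
have lift_o : lift o = Y0.
  apply: (centered_uniq (liftP o)); split => // i.
  by rewrite subrr abs0 // (abs_ge0 vP).
have fo : f o = o by apply: T_inj; rewrite fE.
pose w i (y : T) := (lift y 0 i - Y0 0 i) / c.
have w_int i y : v (w i y) <= 1.
  have [_ _ h] := liftP y.
  by rewrite (absM vP) absV // ler_pdivrMr ?abs_gt0 // mul1r.
have liftE i y : lift y 0 i = Y0 0 i + c * w i y.
  by rewrite /w mulrC divfK // addrC subrK.
have w_inj y z : (forall i, w i y = w i z) -> y = z.
  move=> h; apply: T_inj; have [hy _ _] := liftP y; have [hz _ _] := liftP z.
  apply: (hcoords_inj hy); suff -> : lift y = lift z by [].
  by apply/rowP => i; rewrite !liftE h.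
pose fo_map := first_order v f g w c.
have fo_lift i : fo_map (fun y => lift y 0 i).
  have -> : (fun y => lift y 0 i) = (fun y => Y0 0 i + c * w i y).
    by apply/funext => y.
  apply: first_orderD => //; [exact: first_order_cst|exact: first_order_coord].
have fo_Z i : fo_map (fun y => poly_map s (lift y) 0 i).
  apply: (integral_poly_map_ind vP (P := fo_map)) => //.
  - by move=> *; exact: first_order_cst.
  - by move=> *; exact: first_orderD.
  - by move=> *; exact: first_orderM.
have liftf y : lift (f y) = (poly_map s (lift y) 0 a)^-1 *: poly_map s (lift y).
  apply: (centered_uniq (liftP (f y))); rewrite fE.
  by have [] := hs _ _ (Cpt y) (liftP y).
have fo_liftf i : fo_map (fun y => lift (f y) 0 i).
  have -> : (fun y => lift (f y) 0 i) =
     (fun y => (poly_map s (lift y) 0 a)^-1 * poly_map s (lift y) 0 i).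
    by apply/funext => y; rewrite liftf mxE.
  apply: first_orderM; [by []|by []| |exact: (fo_Z i)].
  apply: (first_orderV vP w_int c1 (u := fun y => poly_map s (lift y) 0 a)).
    exact: (fo_Z a).
  by move=> y; have [] := hs _ _ (Cpt y) (liftP y).
have [bk bkP] : {bk : 'I_N.+1 -> ('I_N.+1 -> K) * (T -> K) & forall i,
    [/\ forall j, v ((bk i).1 j) <= 1, integral_fun v f g w (bk i).2 & forall y,
      w i (f y) = \sum_(j < N.+1) (bk i).1 j * w j y
                  + c * ((bk i).2 y - (bk i).2 o)]}.
  apply: (@choice 'I_N.+1 (('I_N.+1 -> K) * (T -> K))%type (fun i' bk =>
    [/\ forall j, v (bk.1 j) <= 1, integral_fun v f g w bk.2 & forall y,
      w i' (f y) = \sum_(j < N.+1) bk.1 j * w j y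
                  + c * (bk.2 y - bk.2 o)])) => i.
  have [q [b [l [_ hb hl e]]]] := fo_liftf i.
  have eo : Y0 0 i = q + c ^+ 2 * l o.
    have := e o; rewrite fo lift_o big1 ?mulr0 ?addr0 // => j _.
    by rewrite /w lift_o subrr mul0r mulr0.
  exists (b, l); split => // y; rewrite [LHS]/w e eo /=.
  set S := \sum_(j < N.+1) _; by field.
pose A : 'M[K]_N.+1 := \matrix_(i, j) (bk i).1 j.
have A_int i j : v (A i j) <= 1 by rewrite mxE; have [] := bkP i.
have [n n0 hn] := idempotent_mod_maximal p_prime padic redP A_int.
have [t t1 ht] := finite_family_lt1 (F := fun ij : 'I_N.+1 * 'I_N.+1 =>
  v ((A ^+ n * A ^+ n - A ^+ n) ij.1 ij.2)) (fun ij => hn ij.1 ij.2).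
(* one modulus that accounts for the scaling, for [p] and for the idempotency *)
have [b b0 /andP[sb b1]] : exists2 b : K, b != 0 &
    Num.max t (Num.max (v c) (v p%:R)) <= v b < 1.
  apply: (exists_abs_between vP (p_neq0 p_prime padic)).
    exact: abs_p_lt1 padic.
  by rewrite !gt_max t1 c1 (abs_p_lt1 p_prime padic).
move: sb; rewrite !ge_max => /and3P[tb cb pb].
have lin : linear_mod v f g w b A f.
  exists (fun i y => c / b * ((bk i).2 y - (bk i).2 o)).
    move=> i; have [_ ik _] := bkP i; apply: integralM.
      apply: integral_cst; rewrite (absM vP) absV // ler_pdivrMr ?abs_gt0 //.
      by rewrite mul1r.
    apply: integralD => //; apply: integral_cst.
    by rewrite absN // (integral_le1 vP _ ik).
  move=> y; apply/matrixP => i j; rewrite !mxE; have [_ _ ->] := bkP i.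
  rewrite mulrA [b * _]mulrC divfK //; congr (_ + _).
  by apply: eq_bigr => l _; rewrite !mxE.
have [n' n'0 hn'] := periodic_common_period vP fK gK w_int w_inj p_prime
  (abs_p_lt1 p_prime padic) (p_neq0 p_prime padic) b0 b1 pb A_int n0
  (fun i j => le_trans (ht (i, j)) tb) lin.
exists (n' * m)%N; first by rewrite muln_gt0 n'0.
move=> y hy; pose yT : T := exist _ y hy.
have [q q0 qy] := f_per yT.
by have /(congr1 sval) := hn' _ _ q0 qy; rewrite fiterE.
Qed.

End Disc.
End ResidueDisc.

(** * Periodic points in discs of radius less than 1 *)

Section UnitCoordinates.
Variables (R : realType) (K : fieldType) (v : K -> R) (N : nat).
Hypothesis vP : nonarchimedean v.

Lemma unit_coordsP (x : pspace K N) :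
  [/\ hcoords x (unit_coords v x), int_row v (unit_coords v x) &
      exists a, unit_coords v x 0 a = 1].
Proof.
rewrite /unit_coords; have hx := hcoords_vpick x; set X := vpick _ in hx *.
set a := [arg max_(i > ord0) v (X 0 i)]%O.
have amax i : v (X 0 i) <= v (X 0 a).
  by rewrite /a; case: arg_maxP => // j _ hj; apply: hj.
have Xa : X 0 a != 0.
  have [i Xi] := rV_neq0 (hcoords_neq0 hx).
  apply: contraNneq Xi => e; apply/eqP/(abs_eq0 vP)/le_anti.
  by rewrite (abs_ge0 vP) andbT -(abs0 vP) -e amax.
split; first by apply: hcoordsZ => //; rewrite invr_eq0.
  by move=> i; rewrite mxE (absM vP) absV // mulrC ler_pdivrMr ?abs_gt0 // mul1r.
by exists a; rewrite mxE mulVf.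
Qed.

Lemma Delta_ge (x y : pspace K N) i j :
  v (unit_coords v x 0 i * unit_coords v y 0 j
     - unit_coords v x 0 j * unit_coords v y 0 i) <= Delta v x y.
Proof.
rewrite /Delta; apply: le_trans (le_bigmax _ _ i).
exact: (le_bigmax _ (fun j => v (unit_coords v x 0 i * unit_coords v y 0 j
     - unit_coords v x 0 j * unit_coords v y 0 i)) j).
Qed.

(** Let [X] and [U] be the unit coordinates of [x] and [y].  As [X a = 1], the
distance bounds [U i - X i * U a]; if [U a] were not a unit, then neither would
be any other [U i]. *)
Lemma Delta_lt_affine (x y : pspace K N) a r :
  unit_coords v x 0 a = 1 -> Delta v x y < r -> r < 1 ->
  exists Y, [/\ hcoords y Y, Y 0 a = 1, int_row v Y &
                forall i, v (Y 0 i - unit_coords v x 0 i) <= r].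
Proof.
move=> Xa Dr r1; have [_ Xint _] := unit_coordsP x.
have [hy Yint [b Yb]] := unit_coordsP y; have D i := Delta_ge x y a i.
set X := unit_coords v x in Xa Xint D *; set Y := unit_coords v y in hy Yint Yb D.
have {}D i : v (Y 0 i - X 0 i * Y 0 a) < r.
  by have := D i; rewrite Xa mul1r => /le_lt_trans; apply.
have Ya1 : v (Y 0 a) = 1.
  apply/le_anti; rewrite Yint leNgt; apply/negP => h.
  have := absD_lt vP (lt_trans (D b) r1) (absM_lt1 vP (Xint b) h).
  by rewrite subrK Yb abs1 // ltxx.
have Ya0 : Y 0 a != 0.
  by apply: contra_eq_neq Ya1 => ->; rewrite abs0 // eq_sym oner_eq0.
exists ((Y 0 a)^-1 *: Y); split.
- by apply: hcoordsZ => //; rewrite invr_eq0.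
- by rewrite mxE mulVf.
- by move=> i; rewrite mxE (absM vP) absV // Ya1 invr1 mul1r.
- move=> i; rewrite mxE.
  have -> : (Y 0 a)^-1 * Y 0 i - X 0 i = (Y 0 a)^-1 * (Y 0 i - X 0 i * Y 0 a).
    by field.
  by rewrite (absM vP) absV // Ya1 invr1 mul1r ltW.
Qed.

End UnitCoordinates.

Theorem corollary2
  (R : realType) (p : nat) (p_prime : prime p)
  (Qp : fieldType) (Qpbar : closedFieldType) (emb : {rmorphism Qp -> Qpbar})
  (v : Qpbar -> R) (Qpbar_closure : is_padic_closure p emb v)
  (Fpbar : closedFieldType) (red : Qpbar -> Fpbar)
  (red_residue : is_reduction v red)
  (N : nat) (C : set (pspace Qpbar N)) (C_curve : irreducible_curve C)
  (t : nat) (f : 'I_t -> {mpoly Qpbar[N.+1]})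
  (f_gen : generates_int_ideal v C f)
  (C_smooth : smooth_curve C f)
  (C_good : curve_good_reduction v red C f)
  (F : N.+1.-tuple {mpoly Qpbar[N.+1]})
  (phi : pspace Qpbar N -> pspace Qpbar N)
  (phi_morphism : is_morphism C F phi)
  (phi_good : morphism_good_reduction v red C F)
  (d : nat) (phi_degree : morphism_degree C F d) (d_gt1 : (1 < d)%N)
  (x : pspace Qpbar N) (x_in_C : C x) (r : R) (r_lt1 : r < 1) :
  finite_set [set y | [/\ C y, periodic phi y & Delta v x y < r]].
Proof.
have vP := padic_nonarchimedean Qpbar_closure.
apply: contrapT => Sinf; set S := [set y | _] in Sinf.
have [_ Xint [a Xa]] := unit_coordsP vP x.
have [c c0 /andP[rc c1]] := exists_abs_between vP (p_neq0 p_prime Qpbar_closure)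
  (abs_p_lt1 p_prime Qpbar_closure) r_lt1.
have chart y : S y -> exists Y, [/\ hcoords y Y, Y 0 a = 1, int_row v Y &
    forall i, v (Y 0 i - unit_coords v x 0 i) <= v c].
  move=> [_ _ Dr]; have [Y [hY Ya Yint YX]] := Delta_lt_affine vP Xa Dr r_lt1.
  by exists Y; split => // i; apply: le_trans rc.
have [y0 Sy0] : S !=set0.
  by apply/set0P/eqP => S0; apply: Sinf; rewrite S0; exact: finite_set0.
have [Cy0 [m m0 y0_per] _] := Sy0.
have [Y0 [hY0 Y0a Y0int Y0X]] := chart _ Sy0.
have [n n0 hn] := disc_common_period p_prime Qpbar_closure red_residue C_curve
  phi_morphism phi_good Cy0 c0 c1 m0 y0_per hY0 Y0a Y0int.
have Fix_inf : infinite_set [set y | C y /\ iter n phi y = y].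
  apply: sub_infinite_set Sinf => y Sy; have [Cy y_per _] := Sy; split => //.
  apply: hn; split => //; have [Y [hY Ya _ YX]] := chart _ Sy.
  exists Y; split => // i.
  have -> : Y 0 i - Y0 0 i = (Y 0 i - unit_coords v x 0 i)
      - (Y0 0 i - unit_coords v x 0 i) by ring.
  exact: absB_le.
have := morphism_degree_le1 C_curve phi_morphism n0 Fix_inf phi_degree.
by rewrite leqNgt d_gt1.
Qed.
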